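(* Let $Z(t),t\in\mathcal T$ be a random process with $\mathbb E\{e^{Z(t)}\}=1$ for all $t\in\mathcal T$, and let $\zeta_Z$ be its associated max-stable process. i) Let $h\in\mathcal T$ satisfy $\mathbb P\{Z(h)>-\infty\}=1$. Then for any distinct $t_1=h,t_2,\ldots,t_n\in\mathcal T$, $$\bigl(\Xi_hZ(t_2),\ldots,\Xi_hZ(t_n)\bigr)\overset{d}{=}\bigl(W^{(h)}_2-W^{(h)}_1,\ldots,W^{(h)}_n-W^{(h)}_1\bigr),$$ where $W^{(h)}=(W^{(h)}_1,\ldots,W^{(h)}_n)$ has the conditional law of $W=(W_1,\ldots,W_n)$ given that the component of $W$ corresponding to the point $h=t_1$ is positive, i.e. $W_1>0$, and $W$ is the random vector with the generalised Pareto distribution function $G$ associated to $(\zeta_Z(t_1),\ldots,\zeta_Z(t_n))$. ii) Suppose that $\mathbb P\{Z(h)>-\infty\}=1$ for every $h\in\mathcal T$. Let $\mu$ be a positive (nonzero) $\sigma$-finite measure on $\mathcal T$ such that $\mathcal S_Z=\int_{\mathcal T}e^{Z(s)}\mu(ds)$ is a random variable with $\mathbb P\{\mathcal S_Z<\infty\}=1$, and let $\Pi_\mu=\sum_{i\ge1}\varepsilon_{(P_i,T_i)}$ be a Poisson point process on $\mathbb R\times\mathcal T$ with intensity $e^{-p}dp\cdot\mu(dt)$, independent of anything else. Then, in the sense of equality of all finite dimensional distributions, $$\zeta_Z(t)\overset{fdd}{=}\max_{i\ge1}\Bigl(P_i+\Xi_{T_i}Z_i(t)-\ln\int_{\mathcal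 T}e^{\Xi_{T_i}Z_i(s)}\,\mu(ds)\Bigr),\qquad t\in\mathcal T.$$
   Context: $\mathcal T=\mathbb R^d$ or $\mathcal T=\mathbb Z^d$, $d\ge1$. Processes $Z(t),t\in\mathcal T$ take values in $[-\infty,\infty)$, with $e^{-\infty}=0$; $\overset{fdd}{=}$ means equality of all finite dimensional distributions. Associated max-stable process: $\zeta_Z(t)=\max_{i\ge1}(P_i+Z_i(t))$, $t\in\mathcal T$, where $\sum_i\varepsilon_{P_i}$ is a Poisson point process on $\mathbb R$ with intensity $e^{-x}dx$ and $Z_i$ are independent copies of $Z$, independent of the point process. Since $\mathbb E\{e^{Z(t)}\}=1$, its marginals are unit Gumbel, $e^{-e^{-x}}$. Tilting: let $\mathcal F_{-\infty}$ be the set of functions $\mathcal T\to[-\infty,\infty)$ excluding the function identically $-\infty$, with $\sigma$-field $\mathcal B(\mathcal F_{-\infty})$ generated by the evaluation maps. The tilt $Z^{[h]}$ of $Z$ by $Z(h)$ is the process with law $\mathbb P\{Z^{[h]}\in A\}=\mathbb E\{e^{Z(h)}\mathbb I\{Z\in A\}\}$, $A\in\mathcal B(\mathcal F_{-\infty})$. If $\mathbb P\{Z(h)>-\infty\}=1$, the tilted spectral process is $\Xi_hZ(t)=Z^{[h]}(t)-Z^{[h]}(h)$, $t\in\mathcal T$. Associated generalised Pareto distribution: for distinct $t_1,\ldots,t_n\in\mathcal T$ let $H$ be the distribution function of $(\zeta_Z(t_1),\ldots,\zeta_Z(t_n))$ (one has $H(0,\ldots,0)>0$). Then $W=(W_1,\ldots,W_n)$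 is a random vector with distribution function $$G(x)=\frac1{\ln H(0,\ldots,0)}\ln\Bigl(\frac{H(\min(x_1,0),\ldots,\min(x_n,0))}{H(x)}\Bigr);$$ components of $W$ may take the value $-\infty$ with positive probability. In the representation in ii), $\Xi_{T_i}Z_i$ means: conditionally on the points $(P_i,T_i)_{i\ge1}$, the processes $\Xi_{T_i}Z_i$ are independent, the $i$-th one having the law of $\Xi_hZ$ with $h=T_i$.
   Formalization: In ii) the process Z and the processes Ξ_{T_i}Z_i are additionally assumed jointly measurable in time and outcome (automatic for Z^d); for R^d the claim can fail without this, since the integral of e^Z along a path is not determined by the finite dimensional distributions. *)

(* Defs.v *)
From HB Require Import structures.
From mathcomp Require Import all_boot all_order all_algebra.
(* [all_analysis] does not export [measurable_realfun], which carries the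
   measurable structure of [\bar R]. *)
From mathcomp Require Import all_classical all_reals all_analysis.
From mathcomp Require Import measurable_realfun.

Set Implicit Arguments.
Unset Strict Implicit.
Unset Printing Implicit Defensive.

Import Order.TTheory GRing.Theory Num.Theory numFieldNormedType.Exports.

Local Open Scope classical_set_scope.
Local Open Scope ring_scope.
Local Open Scope ereal_scope.

HB.instance Definition _ := isPointed.Build int 0%R.
HB.instance Definition _ := @isMeasurable.Build default_measure_display
  int discrete_measurable discrete_measurable0
  discrete_measurableC discrete_measurableU.

Variant coordinate_kind := RealCoordinates | IntegerCoordinates.

Definition coordinate (R : realType) (k : coordinate_kind) :
    measurableType default_measure_display :=
  match k with RealCoordinates => R | IntegerCoordinates => int end.

(* R^d with its Borel sigma-field, or Z^d with the discrete one. *)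
Definition index_space (R : realType) (k : coordinate_kind) (d : nat) :
    measurableType (measure_tuple_display default_measure_display) :=
  d.-tuple (coordinate R k).

Section SigmaFields.
Context d (E : measurableType d) (I Omega : Type).

(* The sigma-field on D generated by the restrictions to D of the X i. *)
Definition sigma_gen (D : set Omega) (X : I -> Omega -> E) : set (set Omega) :=
  <<s D, \bigcup_i preimage_set_system D (X i) measurable >>.

End SigmaFields.

Section Processes.
Context (R : realType) (T : Type).

Definition is_process d (Omega : measurableType d) (Z : T -> Omega -> \bar R) :=
  (forall t, measurable_fun setT (Z t)) /\ (forall t w, Z t w < +oo).

Definition path_events : set (set (T -> \bar R)) :=
  sigma_gen setT (fun t (f : T -> \bar R) => f t).

(* The functions T -> [-oo, +oo) that are not identically -oo. *)
Definition paths : set (T -> \bar R) :=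
  [set f | (forall t, f t < +oo) /\ (exists t, -oo < f t)].

Definition paths_borel : set (set (T -> \bar R)) :=
  sigma_gen paths (fun t (f : T -> \bar R) => f t).

End Processes.

Section Laws.
Context (R : realType) d (Omega : measurableType d) (P : probability Omega R).

Definition eq_law n (X : 'I_n -> Omega -> \bar R)
    d' (Omega' : measurableType d') (P' : probability Omega' R)
    (X' : 'I_n -> Omega' -> \bar R) :=
  forall B : set (n.-tuple (\bar R)), measurable B ->
    P [set w | B [tuple X j w | j < n]] = P' [set w | B [tuple X' j w | j < n]].

Definition eq_fdd (T : Type) (Z : T -> Omega -> \bar R)
    d' (Omega' : measurableType d') (P' : probability Omega' R)
    (Z' : T -> Omega' -> \bar R) :=
  forall n (t : 'I_n -> T), eq_law (fun j => Z (t j)) P' (fun j => Z' (t j)).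

(* X' has the conditional law of X given the event C. *)
Definition has_conditional_law n (X : 'I_n -> Omega -> \bar R) (C : set Omega)
    d' (Omega' : measurableType d') (P' : probability Omega' R)
    (X' : 'I_n -> Omega' -> \bar R) :=
  forall B : set (n.-tuple (\bar R)), measurable B ->
    P' [set w | B [tuple X' j w | j < n]] =
    P ([set w | B [tuple X j w | j < n]] `&` C) / P C.

Definition joint_cdf n (X : 'I_n -> Omega -> \bar R) (x : 'I_n -> R) : R :=
  fine (P [set w | forall j, X j w <= (x j)%:E]).

Definition independent_fields (I : eqType) (F : I -> set (set Omega)) :=
  forall (s : seq I) (A : I -> set Omega), uniq s -> (forall i, F i (A i)) ->
    P (\bigcap_(i in [set` s]) A i) = \prod_(i <- s) P (A i).

End Laws.

Section PoissonProcesses.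
Context (R : realType) d (Omega : measurableType d) (P : probability Omega R).

Definition point_count d' (E : measurableType d') (X : nat -> Omega -> E)
    (A : set E) (w : Omega) : \bar R :=
  \sum_(0 <= i <oo) \d_(X i w) A.

(* The second argument of [poisson_prob] is a dummy. *)
Definition poisson_law (N : Omega -> \bar R) (lambda : \bar R) :=
  if lambda == +oo then P [set w | N w = +oo] = 1
  else forall k : nat, P [set w | N w = k%:R%:E] =
                       poisson_prob (fine lambda) 0 [set k].

(* The points are labelled X 0, X 1, ..., and the process is sum_i \d_(X i). *)
Definition poisson_process d' (E : measurableType d') (X : nat -> Omega -> E)
    (nu : set E -> \bar R) :=
  [/\ forall i, measurable_fun setT (X i),
      forall A, measurable A -> poisson_law (point_count X A) (nu A) &
      forall m (A : 'I_m -> set E), (forall j, measurable (A j)) ->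
        trivIset setT A ->
        independent_fields P (fun j =>
          preimage_set_system setT (point_count X (A j)) measurable)].

End PoissonProcesses.

(* The intensity e^(-x) dx on the real line. *)
Section ExpIntensity.
Context (R : realType).

Definition exp_intensity (A : set R) : \bar R :=
  \int[lebesgue_measure]_(x in A) (expR (- x))%:E.

Let exp_intensity0 : exp_intensity set0 = 0.
Proof. by rewrite /exp_intensity integral_set0. Qed.

Let exp_intensity_ge0 A : 0 <= exp_intensity A.
Proof. by apply: integral_ge0 => x _; rewrite lee_fin expR_ge0. Qed.

Let exp_intensity_sigma_additive : semi_sigma_additive exp_intensity.
Proof.
move=> F mF tF mUF; rewrite /exp_intensity ge0_integral_bigcup//=; last first.
  apply: measurable_funTS; apply/measurable_EFinP.
  by apply: measurableT_comp => //; exact: oppr_measurable.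
apply: is_cvg_ereal_nneg_natsum => n _.
by apply: integral_ge0 => x _; rewrite lee_fin expR_ge0.
Qed.

HB.instance Definition _ := isMeasure.Build _ _ _ exp_intensity
  exp_intensity0 exp_intensity_ge0 exp_intensity_sigma_additive.

End ExpIntensity.

Section MaxStable.
Context (R : realType) (T : Type)
  d (Omega : measurableType d) (P : probability Omega R)
  (Z : T -> Omega -> \bar R).

(* The maximum over infinitely many points is taken as a supremum in \bar R.
   Independence is required from the sequence of points, not only from the
   counting measure it induces: the labelling of the points must not depend on
   the copies of Z either. *)
Definition associated_max_stable d' (Omega' : measurableType d')
    (P' : probability Omega' R) (zeta : T -> Omega' -> \bar R) :=
  exists (X : nat -> Omega' -> R) (Zc : nat -> T -> Omega' -> \bar R),
  [/\ poisson_process P' X (@exp_intensity R),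
      forall i, is_process (Zc i) /\ eq_fdd P' (Zc i) P Z,
      independent_fields P' (fun i : option nat =>
        if i is Some j then sigma_gen setT (Zc j) else sigma_gen setT X) &
      forall t w,
        zeta t w = ereal_sup (range (fun i => (X i w)%:E + Zc i t w))].

Definition tilt_law (h : T) (A : set (T -> \bar R)) : \bar R :=
  \int[P]_w (expeR (Z h w) * (\1_A (Z ^~ w))%:E).

Definition is_tilt (h : T) d' (Omega' : measurableType d')
    (P' : probability Omega' R) (Y : T -> Omega' -> \bar R) :=
  [/\ is_process Y, forall w, paths (Y ^~ w) &
      forall A, paths_borel A -> P' [set w | A (Y ^~ w)] = tilt_law h A].

(* The law of Z^[h](t) - Z^[h](h), t in T. *)
Definition spectral_law (h : T) (B : set (T -> \bar R)) : \bar R :=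
  tilt_law h [set f | paths f /\ B (fun t => f t - f h)].

End MaxStable.

(* Given the X i, the processes Y i are independent and Y i has law
   kappa (X i). *)
Definition conditionally_independent (R : realType) (T : Type)
    d (Omega : measurableType d) (P : probability Omega R)
    d' (E : measurableType d') (X : nat -> Omega -> E)
    (Y : nat -> T -> Omega -> \bar R)
    (kappa : E -> set (T -> \bar R) -> \bar R) :=
  forall (m : nat) (A : set Omega) (B : nat -> set (T -> \bar R)),
    sigma_gen setT X A -> (forall i, path_events (B i)) ->
    P (A `&` \bigcap_(i in `I_m) [set w | B i (Y i ^~ w)]) =
    \int[P]_(w in A) \prod_(i < m) kappa (X i w) (B i).

Definition gpd_cdf (R : realType) n (H : ('I_n -> R) -> R) (x : 'I_n -> R) : R :=
  ((ln (H (fun=> 0)))^-1 * ln (H (fun j => Num.min (x j) 0) / H x))%R.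

(* When T is uncountable this is what makes int e^(Z(s)) mu(ds) a random variable
   to which Tonelli's theorem applies, and h |-> spectral_law P Z h B measurable.
   It is automatic for T = Z^d, see [jointly_measurable_integer]. *)
Definition jointly_measurable (R : realType) d (T : measurableType d)
    d' (Omega : measurableType d') (Z : T -> Omega -> \bar R) :=
  measurable_fun [set: T * Omega] (fun x => Z x.1 x.2).

Lemma jointly_measurable_integer (R : realType) (n : nat)
    d (Omega : measurableType d)
    (Z : index_space R IntegerCoordinates n -> Omega -> \bar R) :
  (forall t, measurable_fun setT (Z t)) -> jointly_measurable Z.
Proof.
move=> mZ _ B mB; rewrite setTI.
have mset1 (t : index_space R IntegerCoordinates n) : measurable [set t].
  rewrite (_ : [set t] = \bigcap_(i in [set: 'I_n]) [set u | tnth u i = tnth t i]).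
    apply: fin_bigcap_measurable => // i _.
    have := @measurable_tnth _ (coordinate R IntegerCoordinates) n i measurableT.
    by move=> /(_ [set tnth t i] I); rewrite setTI.
  apply/seteqP; split => [u -> //|u /= tu].
  by apply: eq_from_tnth => i; exact: tu.
rewrite (_ : _ @^-1` B = \bigcup_(t in [set: n.-tuple int])
    ([set t : index_space R IntegerCoordinates n] `*` (Z t @^-1` B))).
  apply: countable_bigcupT_measurable => [|t]; first exact: countableP.
  apply: measurableX => //.
  by rewrite -[X in measurable X]setTI; exact: mZ.
by apply/seteqP; split => [[t w] /= ZB|[t w] [u _ [/= -> //]]]; exists t.
Qed.

(* Main.v *)
Require Import Defs.
From HB Require Import structures.
From mathcomp Require Import all_boot all_order all_algebra.
From mathcomp Require Import all_classical all_reals all_analysis.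
From mathcomp Require Import measurable_realfun ring lra.
Import Order.TTheory GRing.Theory Num.Theory numFieldNormedType.Exports.

(** Write nu for the measure e^(-p) dp. The largest point of a process shifted by
independent marks stays below a level when a marked Poisson process avoids a
set, and this has probability exp of minus the intensity of that set. So
  P(zeta(t_j) <= x_j for all j) = exp(- ell(x)),
where, since nu {p | v < p} = e^(-v),
  ell(x) = (nu x P){p + Z(t_j) > x_j for some j} = E exp(max_j (Z(t_j) - x_j)).
Both assertions are computations with the exponent ell, whose finiteness comes
from E e^(Z(t)) = 1 ([max_stable_cdf], [exponent_measureE]).

Generalised Pareto laws. Inserting H = exp(- ell) in the definition of G gives
G(x) = (ell(min(x,0)) - ell(x)) / ell(0), which is the mass that nu x P, divided
by ell(0), gives to the pairs (p, w) such that the vector p + Z(t_j) is below x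
but not below 0. Hence W is distributed as p + Z under nu x P restricted to the
event that some component is positive ([gpd_law]). On W_1 > 0 that restriction
is automatic, the increments W_j - W_1 = Z(t_j) - Z(h) do not involve p, and
integrating p over p > - Z(h) leaves the weight e^(Z(h)): this is the tilt by
Z(h), up to the constant ell(0) that conditioning removes
([tilted_increments_law]).

The normalised representation. The points (P_i, T_i) marked by the paths
Xi_{T_i} Z_i again form a marked Poisson process, so the maximum on the right
has a distribution function of the same form, with exponent
  int mu(dh) E [e^(Z(h)) exp(max_j (Z(t_j) - Z(h)
                        - ln int e^(Z(s) - Z(h)) mu(ds) - x_j))].
The two occurrences of Z(h) in the inner exponential cancel, what remains is
e^(Z(h)) / S_Z times exp(max_j (Z(t_j) - x_j)), and the integral in h gives back
ell(x) ([integral_normalised_tilt], [normalised_max_cdf]). Boxes determine laws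
on tuples, so the finite dimensional distributions agree.

Two points need care. The points come as a sequence and only the counts of
points in disjoint sets have a known law. The avoidance probability is therefore
obtained as the limit of E prod_(i < m) (1 - g(X_i)); this product depends in the
limit on the counts alone, first for a simple g and then by monotone
approximation ([laplace_functional], [marked_poisson_void]). Secondly, the law
of the paths is given on the product sigma-field only, where the total mass
f |-> int e^(f(s)) mu(ds) is not a measurable functional when T is uncountable.
For jointly measurable processes it agrees almost surely with a functional of
countably many coordinates. Averages along a random sequence of coordinates
converge to the integral by the law of large numbers; choosing the coordinates
greedily, each so as to keep the mean square error small, gives one
deterministic sequence with the same property ([greedy_lln],
[path_integral_functional]). *)

Local Open Scope classical_set_scope.
Local Open Scope ring_scope.
Local Open Scope ereal_scope.

Set Implicit Arguments.
Unset Strict Implicit.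

(** * The intensity of the Poisson points on the line *)

Section ExpIntensityRays.
Context {R : realType}.

Local Notation nu := (@exp_intensity R).

Lemma exp_intensity_ray (r : R) : nu [set p | (r < p)%R] = (expR (- r))%:E.
Proof.
have -> : [set p | (r < p)%R] = `]r, +oo[%classic.
  by apply/seteqP; split => x /=; rewrite in_itv/= andbT.
have cexp : continuous (fun x : R => expR (- x)).
  move=> x; apply: continuous_comp; last exact: continuous_expR.
  exact: (@continuousN _ R^o).
have mexp : measurable_fun setT (fun x : R => (expR (- x))%:E).
  by apply/measurable_EFinP; exact: continuous_measurable_fun.
rewrite /exp_intensity integral_itv_obnd_cbnd; last exact: measurable_funTS.
rewrite (@ge0_continuous_FTC2y _ _ (fun x => - expR (- x))%R _ 0%R).
- by rewrite sub0e EFinN oppeK.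
- by move=> x _; exact: expR_ge0.
- exact: continuous_subspaceT.
- by have := cvgN (@cvgr_expR R); rewrite oppr0; exact.
- by move=> z _; exact: ex_derive.
- by have := cvgN (cvg_at_right_filter (cexp r)); exact.
- move=> z _.
  rewrite derive1N// derive1_comp// derive1N// derive1_id derive1E.
  by have /funeqP -> := @derive_expR R; rewrite mulrN1 opprK.
Qed.

Lemma exp_intensity_eray (v : \bar R) : nu [set p | v < p%:E] = expeR (- v).
Proof.
case: v => [r| |].
- by rewrite -[RHS](exp_intensity_ray r).
- rewrite (_ : [set p | _] = set0); first by rewrite measure0.
  by apply/seteqP; split => x.
- rewrite (_ : [set p | _] = setT); last by apply/seteqP; split => x //= _; rewrite ltNyr.
  have : forall n : nat, (n%:R)%:E <= nu setT.
    move=> n; apply: (@le_trans _ _ (nu [set p | (- n%:R < p)%R])).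
      rewrite exp_intensity_ray opprK lee_fin.
      by apply: le_trans (expR_ge1Dx _); rewrite lerDr.
    apply: le_measure; rewrite ?inE//.
    rewrite (_ : [set p | _] = `](- n%:R)%R, +oo[%classic)//.
    by apply/seteqP; split => x /=; rewrite in_itv/= andbT.
  move=> H.
  rewrite /=; apply/eqyP => r _.
  have [n rn] : exists n : nat, (r < n%:R)%R.
    by exists (Num.trunc `|r|).+1; exact: le_lt_trans (ler_norm _) (truncnS_gt _).
  by apply: le_trans (H n); rewrite lee_fin ltW.
Qed.

Lemma exp_intensity_sigma_finite : sigma_finite setT nu.
Proof.
have E n : [set p : R | (- n%:R < p)%R] = `](- n%:R)%R, +oo[%classic.
  by apply/seteqP; split => x /=; rewrite in_itv/= andbT.
exists (fun n => [set p | (- n%:R < p)%R]) => [|n].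
  apply/seteqP; split => // x _.
  exists (Num.trunc `|x|).+1 => //=.
  by rewrite ltrNl; apply: le_lt_trans (truncnS_gt _); rewrite -normrN ler_norm.
by split; [rewrite E|rewrite exp_intensity_ray ltry].
Qed.

HB.instance Definition _ := Measure_isSigmaFinite.Build _ _ _ nu
  exp_intensity_sigma_finite.
End ExpIntensityRays.

(** * Laws on tuples are determined by boxes *)

Section UniqueLaw.
Context {R : realType} {d} {S : measurableType d}.
Variables (m1 m2 : {measure set S -> \bar R}).
Hypothesis m1fin : m1 setT < +oo.

(** A uniqueness theorem on the sigma-field generated by G alone: total masses are
compared directly, so that G need not contain sets exhausting the space. This
matters for boxes with finite corners, which leave out the value +oo. *)
Lemma sub_sigma_measure_unique (G : set (set S)) :
  setI_closed G -> G `<=` measurable ->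
  m1 setT = m2 setT -> (forall A, G A -> m1 A = m2 A) ->
  forall A, <<s G>> A -> m1 A = m2 A.
Proof.
move=> GI Gm mT mG A sA.
suff /(_ A sA)[] : <<s G>> `<=` [set A | measurable A /\ m1 A = m2 A] by [].
apply: lambda_system_subset => //.
  apply/dynkin_lambda_system; split => //.
  - move=> B [mB eB]; split; first exact: measurableC.
    have m2fin : m2 setT < +oo by rewrite -mT.
    rewrite -setTD (measureD _ mB m1fin)// (measureD _ mB m2fin)// setTI.
    exact: (congr2 (fun a b => a - b) mT eB).
  - move=> F tF mF; split; first by apply: bigcupT_measurable => n; case: (mF n).
    rewrite !measure_semi_bigcup//.
    + by apply: eq_eseriesr => n _; case: (mF n).
    + by move=> n; case: (mF n).
    + by apply: bigcupT_measurable => n; case: (mF n).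
    + by move=> n; case: (mF n).
    + by apply: bigcupT_measurable => n; case: (mF n).
by move=> B GB; split; [exact: Gm|exact: mG].
Qed.
End UniqueLaw.

Section TupleLaw.
Context {R : realType} (n : nat).
Implicit Types x : 'I_n -> \bar R.

Definition box x : set (n.-tuple (\bar R)) := [set y | forall j, tnth y j <= x j].

Lemma measurable_box x : measurable (box x).
Proof.
rewrite (_ : box x = \bigcap_(j in [set: 'I_n]) [set y | tnth y j <= x j]).
  apply: fin_bigcap_measurable => // j _.
  rewrite -[X in measurable X]setTI.
  by apply: emeasurable_fun_infty_c => //; exact: measurable_tnth.
by apply/seteqP; split => y /= H j; [move=> _; exact: H|exact: H].
Qed.

(** The trace on D is needed because boxes with finite corners generate the Borel
sets only away from the tuples that have an infinite coordinate +oo. *)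
Lemma trace_boxes (G : set (set (n.-tuple (\bar R)))) (D : set (n.-tuple (\bar R))) :
  <<s G>> D -> (forall i (r : R), <<s G>> (D `&` [set y | tnth y i <= r%:E])) ->
  forall A, measurable A -> <<s G>> (D `&` A).
Proof.
move=> sD sray A mA.
have sGsigma : sigma_algebra setT <<s G>> by exact: smallest_sigma_algebra.
have traceS : sigma_algebra setT [set A | <<s G>> (D `&` A)].
  have [G0 GC GU] := sGsigma.
  split => /=.
  - by rewrite setI0.
  - move=> B sB; rewrite setTD -setDE.
    rewrite (_ : D `\` B = ~` ((~` D) `|` (D `&` B))); last first.
      apply/seteqP; split => y /=; first by move=> [Dy nBy] [|[]].
      move=> H; split; first by apply: contrapT => nD; apply: H; left.
      by move=> By; apply: H; have [Dy|nDy] := pselect (D y); [right|left].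
    rewrite -setTD; apply: (GC); rewrite -bigcup2E; apply: GU => -[|[|k]] //=.
    by rewrite -setTD; exact: GC.
  - by move=> F sF; rewrite setI_bigcupr; exact: GU.
suff : measurable `<=` [set A | <<s G>> (D `&` A)] by exact.
apply: smallest_sub => //; rewrite -bigcup_seq => B /= [i _ [C mC <-{B}]].
rewrite setTI.
suff : @measurable _ (\bar R) `<=` image_set_system setT
    (fun y : n.-tuple (\bar R) => tnth y i) [set A | <<s G>> (D `&` A)].
  by move=> /(_ C mC); rewrite /image_set_system/= setTI.
have -> : @measurable _ (\bar R) = (@ErealGenOInfty.G R).-sigma.-measurable.
  exact: ErealGenOInfty.measurableE.
apply: smallest_sub; first exact: sigma_algebra_image.
move=> _ [r ->]; rewrite /image_set_system/= setTI.
rewrite (_ : D `&` _ = D `\` (D `&` [set y | tnth y i <= r%:E])); last first.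
  apply/seteqP; split => y /=; rewrite in_itv/= andbT.
    by move=> [Dy ry]; split => // -[_]; rewrite leNgt ry.
  by move=> [Dy H]; split => //; rewrite ltNge; apply/negP => H'; apply: H.
rewrite setDE setCI; case: traceS => _ TC _.
rewrite setIUr setICr set0U -setTD; apply: TC => /=.
exact: sray.
Qed.

Lemma setI_closed_box (P : set ('I_n -> \bar R)) :
  (forall x y, P x -> P y -> P (fun j => mine (x j) (y j))) ->
  setI_closed (box @` P).
Proof.
move=> Pmin _ _ [x Px <-] [y Py <-].
exists (fun j => mine (x j) (y j)); first exact: Pmin.
apply/seteqP; split => z /=.
  by move=> H; split => j; have := H j; rewrite le_min => /andP[].
by move=> [H1 H2] j; rewrite le_min H1 H2.
Qed.

Variables m1 m2 : {measure set (n.-tuple (\bar R)) -> \bar R}.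

(** With corners allowed to be +oo, one coordinate at a time can be constrained, so
the boxes generate the whole product sigma-field. *)
Lemma eq_measure_box : m1 setT < +oo ->
  (forall x, m1 (box x) = m2 (box x)) ->
  forall A, measurable A -> m1 A = m2 A.
Proof.
move=> m1fin m12 A mA.
have boxT : setT = box (fun=> +oo) by apply/seteqP; split => y //= _ j; rewrite leey.
apply: (@sub_sigma_measure_unique _ _ _ m1 m2 m1fin (box @` setT)) => //.
- exact: setI_closed_box.
- by move=> _ [x _ <-]; exact: measurable_box.
- by rewrite boxT m12.
- by move=> _ [x _ <-]; exact: m12.
rewrite -(setTI A); apply: trace_boxes => //.
  by rewrite boxT; apply: sub_sigma_algebra; exists (fun=> +oo).
move=> i r; apply: sub_sigma_algebra.
exists (fun j => if j == i then r%:E else +oo) => //.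
rewrite setTI; apply/seteqP; split => y /=; first by move=> /(_ i); rewrite eqxx.
by move=> H j; case: eqVneq => [->//|_]; rewrite leey.
Qed.

(** A distribution function is given at real arguments only, hence the separate
control of the mass at +oo; mass at -oo is seen by every box. *)
Lemma eq_measure_fin_box : m1 setT < +oo -> m1 setT = m2 setT ->
  m1 [set y | exists j, tnth y j = +oo] = 0 ->
  m2 [set y | exists j, tnth y j = +oo] = 0 ->
  (forall x : 'I_n -> R, m1 (box (EFin \o x)) = m2 (box (EFin \o x))) ->
  forall A, measurable A -> m1 A = m2 A.
Proof.
move=> m1fin mT m1y m2y m12 A mA.
pose D : set (n.-tuple (\bar R)) := ~` [set y | exists j, tnth y j = +oo].
pose G := box @` [set x | exists r : 'I_n -> R, x = EFin \o r].
have mG : G `<=` measurable by move=> _ [x _ <-]; exact: measurable_box.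
have bnd (y : n.-tuple (\bar R)) : D y -> exists k : nat, forall j, tnth y j <= k%:R%:E.
  move=> Dy; have: forall j, exists k : nat, tnth y j <= k%:R%:E.
    move=> j; have: tnth y j != +oo by apply/eqP => yj; apply: Dy; exists j.
    case: (tnth y j) => [s _| //|]; last by exists 0%N; rewrite leNye.
    exists (Num.trunc `|s|).+1; rewrite lee_fin.
    by apply: le_trans (ler_norm _) _; apply: ltW; exact: truncnS_gt.
  move=> /choice[f fy]; exists (\max_j f j) => j; apply: le_trans (fy j) _.
  by rewrite lee_fin ler_nat; exact: leq_bigmax.
have Dbox (k : nat) : box (fun=> k%:R%:E) `<=` D.
  by move=> y /= yk [j yj]; have := yk j; rewrite yj leye_eq.
have sD : <<s G>> D.
  rewrite (_ : D = \bigcup_k box (fun=> k%:R%:E)).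
    apply: sigma_algebra_bigcup => k; apply: sub_sigma_algebra.
    by exists (fun=> k%:R%:E) => //; exists (fun=> k%:R).
  apply/seteqP; split => y; last by move=> [k _ /Dbox].
  by move=> /bnd[k yk]; exists k.
have sray i (r : R) : <<s G>> (D `&` [set y | tnth y i <= r%:E]).
  rewrite (_ : _ `&` _ =
    \bigcup_(k : nat) box (EFin \o (fun j => if j == i then r else k%:R))).
    by apply: sigma_algebra_bigcup => k; apply: sub_sigma_algebra; eexists; [eexists|].
  apply/seteqP; split => y /=.
    by move=> [/bnd[k yk] yr]; exists k => // j /=; case: eqVneq => [->|_].
  move=> [k _ yk]; split; last by have := yk i; rewrite /= eqxx.
  by move=> [j yj]; have := yk j; rewrite /= yj leye_eq.
have mD : measurable (~` D).
  rewrite setCK (_ : [set y | _] = \bigcup_(j in [set: 'I_n]) [set y | tnth y j = +oo]).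
    apply: fin_bigcup_measurable => // j _.
    have := @measurable_tnth _ (\bar R) n j measurableT [set +oo] (emeasurable_set1 _).
    by rewrite setTI.
  by apply/seteqP; split => y /=; [move=> [j yj]; exists j|move=> [j _ yj]; exists j].
have mDD : measurable D by rewrite -[D]setCK; exact: measurableC.
have e1 (m : {measure set (n.-tuple (\bar R)) -> \bar R}) :
    m (~` D) = 0 -> m A = m (D `&` A).
  move=> m0; rewrite (measureDI m mA mDD)/= setDE.
  rewrite (@subset_measure0 _ _ _ m (A `&` ~` D) (~` D)) ?add0e 1?setIC//.
  exact: measurableI.
rewrite e1 ?setCK// [RHS]e1 ?setCK//.
apply: (@sub_sigma_measure_unique _ _ _ m1 m2 m1fin G) => //.
- apply: setI_closed_box => _ _ [x ->] [y ->].
  by exists (fun j => Num.min (x j) (y j)); apply/funext => j /=; rewrite EFin_min.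
- by move=> _ [_ [x ->] <-]; exact: m12.
exact: trace_boxes.
Qed.

End TupleLaw.

(** * Independence and thinning *)

Section Independence.
Context {R : realType} {d} {Omega : measurableType d} (P : probability Omega R).
Context {I : eqType} (F : I -> set (set Omega)).
Variables (a : I -> nat -> R) (B : I -> nat -> set Omega) (f : I -> Omega -> R).

(** Each f i is a countable combination of indicators of events of F i, so the
product rule for events passes to expectations by linearity, one factor at a
time. Countably many values are enough here: the functions of interest depend on
the number of points in a set. *)
Lemma independent_expectation :
  independent_fields P F -> (forall i, F i `<=` measurable) ->
  (forall i k, F i (B i k)) -> (forall i k, (0 <= a i k)%R) ->
  (forall i w, (0 <= f i w <= 1)%R) ->
  (forall i w, (f i w)%:E = \sum_(0 <= k <oo) ((a i k)%:E * (\1_(B i k) w)%:E)) ->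
  forall s : seq I, uniq s ->
  \int[P]_w (\prod_(i <- s) f i w)%:E = \prod_(i <- s) \int[P]_w (f i w)%:E.
Proof.
move=> indF mF FB a0 f01 fE.
have mB i k : measurable (B i k) by exact: mF (FB i k).
have t0 i k w : 0 <= (a i k)%:E * (\1_(B i k) w)%:E.
  by rewrite mule_ge0// lee_fin// indicE.
have m1B i k D : measurable_fun D (fun w => (\1_(B i k) w)%:E : \bar R).
  by apply: measurable_funTS; apply/measurable_EFinP; exact: measurable_indic.
have mterm i k : measurable_fun setT (fun w => (a i k)%:E * (\1_(B i k) w)%:E).
  by apply: emeasurable_funM.
have mf i : measurable_fun setT (f i).
  apply/measurable_EFinP; rewrite (_ : _ \o _ = fun w => (f i w)%:E)//.
  by under eq_fun do rewrite fE; exact: ge0_emeasurable_sum.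
have mp (s : seq I) : measurable_fun setT (fun w => (\prod_(i <- s) f i w)%R).
  by apply: measurable_prod.
have p0 (s : seq I) w : (0 <= \prod_(i <- s) f i w)%R.
  by apply: prodr_ge0 => i _; case/andP: (f01 i w).
have f0 i w : 0 <= (f i w)%:E by rewrite lee_fin; case/andP: (f01 i w).
pose c i := \int[P]_w (f i w)%:E.
have cE i : c i = \sum_(0 <= k <oo) ((a i k)%:E * P (B i k)).
  rewrite /c; under eq_integral do rewrite fE.
  rewrite integral_nneseries//; apply: eq_eseriesr => k _.
  by rewrite ge0_integralZl// ?lee_fin// integral_indic// setIT.
have cfin i : c i \is a fin_num.
  rewrite ge0_fin_numE ?integral_ge0//; apply: (@le_lt_trans _ _ 1); last exact: ltry.
  rewrite -(@probability_setT _ _ _ P) -[leRHS]mul1e -integral_cst//.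
  apply: ge0_le_integral => //.
  - by apply/measurable_EFinP.
  - by move=> w _; rewrite lee_fin; case/andP: (f01 i w).
(* The induction replaces f i by its expectation along s1 while the factors already
   expanded, along s2, are kept as events. *)
suff H : forall s1 s2 : seq I, uniq (s1 ++ s2) -> forall A : I -> set Omega,
    (forall i, F i (A i)) ->
    \int[P]_(w in \bigcap_(i in [set` s2]) A i) (\prod_(i <- s1) f i w)%:E =
    \prod_(i <- s1) c i * \prod_(i <- s2) P (A i).
  move=> s us.
  have := H s [::]; rewrite cats0 => /(_ us (fun i => B i 0%N) (fun i => FB i 0%N)).
  rewrite big_nil mule1 => <-; congr integral.
  by apply/seteqP; split => // w _ i /=; rewrite in_nil.
have mD (C : I -> set Omega) (s : seq I) : (forall i, F i (C i)) ->
    measurable (\bigcap_(i in [set` s]) C i).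
  by move=> FC; apply: fin_bigcap_measurable => // i _; exact: mF.
elim => [|j s1 IH] s2 us A FA.
  rewrite big_nil mul1e -indF//.
  under eq_integral do rewrite big_nil.
  by rewrite integral_cst ?mul1e//; exact: mD.
set D := \bigcap_(i in _) _.
have step k : \int[P]_(w in D) ((a j k)%:E * ((\1_(B j k) w)%:E * (\prod_(i <- s1) f i w)%:E)) =
   (\prod_(i <- s1) c i * \prod_(i <- s2) P (A i)) * ((a j k)%:E * P (B j k)).
  have mDD : measurable D by exact: mD.
  rewrite ge0_integralZl//; last 3 first.
  - apply: emeasurable_funM => //; apply/measurable_EFinP.
    exact: measurable_funTS.
  - by move=> w _; rewrite mule_ge0// ?lee_fin// indicE.
  - by rewrite lee_fin.
  pose A' i := if i == j then B j k else A i.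
  have FA' i : F i (A' i) by rewrite /A'; case: eqP => [->|].
  have := IH (j :: s2) _ A' FA'.
  have -> : uniq (s1 ++ j :: s2) by rewrite -cat1s uniq_catCA.
  move=> /(_ isT).
  have jNs2 : j \notin s2 by move: us; rewrite /= mem_cat negb_or => /andP[/andP[]].
  have -> : \bigcap_(i in [set` j :: s2]) A' i = D `&` B j k.
    apply/seteqP; split => w /=.
      move=> H; split; last by have := H j; rewrite /A' eqxx; apply; rewrite /= mem_head.
      move=> i /= is2; have := H i; rewrite /A'; case: eqP => [ij|_]; last first.
        by apply; rewrite /= in_cons is2 orbT.
      by move: jNs2; rewrite -ij is2.
    move=> [Dw Bw] i /=; rewrite in_cons /A'; case: eqP => [->//|_ /= is2].
    exact: Dw.
  rewrite big_cons {1}/A' eqxx.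
  have -> : \prod_(i <- s2) P (A' i) = \prod_(i <- s2) P (A i).
    apply: eq_big_seq => i is2; rewrite /A'; case: eqP => // ij.
    by move: jNs2; rewrite -ij is2.
  move=> E; rewrite [X in _ * X](_ : _ =
      \int[P]_(w in D `&` B j k) (\prod_(i <- s1) f i w)%:E).
    rewrite E; rewrite [RHS]muleCA; congr (_ * _).
    by rewrite [P (B j k) * _]muleC muleA.
  rewrite integral_mkcondr; apply: eq_integral => w _.
  rewrite patchE indicE; case: ifPn => wB; first by rewrite mul1e.
  by rewrite mul0e.
transitivity (\int[P]_(w in D) \sum_(0 <= k <oo)
    ((a j k)%:E * ((\1_(B j k) w)%:E * (\prod_(i <- s1) f i w)%:E))).
  apply: eq_integral => w _; rewrite big_cons EFinM fE muleC -nneseriesZl//.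
  by apply: eq_eseriesr => k _; rewrite muleC muleA.
rewrite integral_nneseries//; last 3 first.
- exact: mD.
- move=> k; apply: emeasurable_funM => //; apply: emeasurable_funM => //.
  by apply/measurable_EFinP; exact: measurable_funTS.
- by move=> k w _; rewrite muleA mule_ge0// lee_fin.
under eq_eseriesr do rewrite step.
have Kfin : \prod_(i <- s1) c i * \prod_(i <- s2) P (A i) \is a fin_num.
  rewrite fin_numM// prode_fin_num// => i _.
  by rewrite fin_num_measure//; exact: mF.
rewrite -(fineK Kfin) nneseriesZl; last first.
  by move=> k _; rewrite mule_ge0// lee_fin.
by rewrite (fineK Kfin) -cE big_cons muleC muleA.
Qed.
End Independence.

Section Thinning.
Context {R : realType}.

Lemma nneseries_exp (x : R) : (0 <= x)%R ->
  \sum_(0 <= k <oo) (x ^+ k / k`!%:R)%:E = (expR x)%:E.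
Proof.
move=> x0; rewrite expRE -EFin_lim; last first.
  rewrite /pseries/=; under eq_fun do rewrite mulrC.
  exact: is_cvg_series_exp_coeff.
apply/congr_lim/funext => n/=; rewrite /pseries/= /series/= -sumEFin//.
by under eq_bigr do rewrite mulrC.
Qed.

Lemma nneseries_single (f : nat -> \bar R) (n : nat) :
  (forall k, 0 <= f k) -> (forall k, k != n -> f k = 0) ->
  \sum_(0 <= k <oo) f k = f n.
Proof.
move=> f0 fn; rewrite (@nneseriesD1 _ _ n)// eseries0 ?adde0// => k _ /= kn.
exact: fn.
Qed.

(** The infinite product is (1 - c) to the power N, where N is the number of indices
i such that b i holds, and vanishes when N is infinite. Writing it as a series over
the finite values of N exhibits it as a function of N. *)
Lemma thinned_product_cvg (b : nat -> bool) (c : R) : (0 < c <= 1)%R ->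
  exists v : R, [/\ (0 <= v <= 1)%R,
    (fun m => \prod_(i < m) (1 - c * (b i)%:R))%R @ \oo --> v &
    v%:E = \sum_(0 <= k <oo) (((1 - c) ^+ k)%:E *
      ((\sum_(0 <= i <oo) (b i)%:R%:E : \bar R) == k%:R%:E)%:R%:E)].
Proof.
move=> /andP[c0 c1]; have q0 : (0 <= 1 - c)%R by rewrite subr_ge0.
have q1 : (1 - c <= 1)%R by rewrite lerBlDr lerDl ltW.
have q1' : (`|1 - c| < 1)%R by rewrite ger0_norm// ltrBlDr ltrDl.
pose u i : nat := b i.
have prodE : (fun m => \prod_(i < m) (1 - c * (b i)%:R))%R =
    (fun m => (1 - c) ^+ nseries u m)%R.
  apply/funext; elim => [|m IH]; first by rewrite big_ord0 /nseries big_geq.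
  rewrite big_ord_recr/= IH /nseries big_nat_recr//= exprD; congr *%R.
  by rewrite /u; case: (b m); rewrite ?mulr1 ?mulr0 ?subr0.
rewrite prodE.
have sumE m : \sum_(0 <= i < m) (b i)%:R%:E = (nseries u m)%:R%:E :> \bar R.
  by rewrite /nseries natr_sum -sumEFin.
have t0 k z : 0 <= ((1 - c) ^+ k)%:E * (z == k%:R%:E :> \bar R)%:R%:E.
  by rewrite mule_ge0// lee_fin// exprn_ge0.
have [/cvg_nseries_near[n _ un]|du] := pselect (cvgn (nseries u)).
  have cst m : (n <= m)%N -> nseries u m = nseries u n.
    move=> nm; rewrite /nseries (@big_cat_nat _ _ _ n)//=.
    rewrite [X in (_ + X)%N]big1_seq ?addn0// => i; rewrite mem_index_iota.
    by move=> /andP[_ /andP[/un]].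
  exists ((1 - c) ^+ nseries u n)%R; split.
  - by rewrite exprn_ge0//= exprn_ile1.
  - by apply: cvg_near_cst; exists n => // m /= /cst ->.
  have -> : \sum_(0 <= i <oo) (b i)%:R%:E = (nseries u n)%:R%:E :> \bar R.
    apply/cvg_lim => //; apply: cvg_near_cst; exists n => // m /= nm.
    by rewrite sumE cst.
  rewrite (@nneseries_single _ (nseries u n))//; first by rewrite eqxx mule1.
  by move=> k kn; rewrite eqe eqr_nat eq_sym (negbTE kn) mule0.
exists 0%R; split; first by rewrite lexx ler01.
- have := cvg_expr q1'; apply: cvg_comp; exact: dvg_nseries.
- rewrite eseries0// => k _ _.
  rewrite (_ : \sum_(0 <= i <oo) _ = +oo) ?mule0//.
  apply/cvg_lim => //; rewrite [X in X @ _ --> _](_ : _ =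
    fun m => (nseries u m)%:R%:E); last by apply/funext => m; rewrite sumE.
  apply/cvgeryP; have := dvg_nseries du.
  move=> H; apply: (cvg_comp _ _ H); exact: cvgr_idn.
Qed.

(** The probability generating function of the Poisson law at 1 - c. For an infinite
mean both sides vanish. *)
Lemma poisson_law_thinned d (Omega : measurableType d) (P : probability Omega R)
    (N : Omega -> \bar R) (lam : \bar R) (c : R) :
  (0 < c <= 1)%R -> 0 <= lam -> measurable_fun setT N -> poisson_law P N lam ->
  \sum_(0 <= k <oo) (((1 - c) ^+ k)%:E * P [set w | N w = k%:R%:E]) =
  expeR (- (c%:E * lam)).
Proof.
move=> /andP[c0 c1] lam0 mN; rewrite /poisson_law.
have q0 : (0 <= 1 - c)%R by rewrite subr_ge0.
have mlev (x : \bar R) : measurable [set w | N w = x].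
  by have := mN measurableT [set x] (emeasurable_set1 _); rewrite setTI.
case: eqP => [->|lamNy] PN.
  rewrite gt0_muley ?lte_fin//= eseries0// => k _ _.
  rewrite (_ : P _ = 0) ?mule0//; apply/eqP; rewrite -measure_le0.
  apply: (@le_trans _ _ (P (~` [set w | N w = +oo]))).
    apply: le_measure; rewrite ?inE//; first exact: measurableC.
    by move=> w /= ->.
  by rewrite probability_setC// PN subee.
case: lam lam0 lamNy PN => // r; rewrite lee_fin => r0 _ PN.
under eq_eseriesr do rewrite PN.
have [r00|rn0] := eqVneq r 0%R.
  rewrite r00 mule0 oppe0 expeR0 (@nneseries_single _ 0%N).
  - by rewrite /poisson_prob ltxx diracE mem_set//= expr0 mule1.
  - by move=> k; rewrite mule_ge0// lee_fin exprn_ge0.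
  - move=> k k0; rewrite /poisson_prob ltxx diracE memNset ?mule0//= => k0'.
    by move: k0; rewrite -k0' eqxx.
have rgt0 : (0 < r)%R by rewrite lt_neqAle eq_sym rn0.
under eq_eseriesr => k _.
  rewrite /poisson_prob rgt0 esum_set1 ?lee_fin ?poisson_pmf_ge0// /poisson_pmf rgt0.
  rewrite -EFinM/= [X in X%:E](_ : (_ = expR (- r) * (((1 - c) * r) ^+ k / k`!%:R))%R); last first.
    by rewrite exprMn; ring.
  rewrite EFinM; over.
rewrite nneseriesZl; last by move=> k _; rewrite lee_fin divr_ge0// exprn_ge0// mulr_ge0.
rewrite nneseries_exp ?mulr_ge0// -EFinM -expRD -EFinM/=; congr (expR _)%:E.
by rewrite mulrBl mul1r addKr.
Qed.

End Thinning.

(** * The Laplace functional of a Poisson process *)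

Section LimitBounds.
Context {R : realType} (u : nat -> \bar R) (l : \bar R).
Hypothesis ul : u @ \oo --> l.

Lemma ecvg_ge_near x : (\forall n \near \oo, x <= u n) -> x <= l.
Proof.
move=> xu; rewrite -(cvg_lim _ ul)//; apply: lime_ge => //.
by apply/cvg_ex; exists l.
Qed.

Lemma ecvg_le_near x : (\forall n \near \oo, u n <= x) -> l <= x.
Proof.
move=> xu; rewrite -(cvg_lim _ ul)//; apply: lime_le => //.
by apply/cvg_ex; exists l.
Qed.

End LimitBounds.

Section BoundedConvergence.
Context {R : realType} {d} {Omega : measurableType d} (P : probability Omega R).

Lemma bounded_convergence (f : nat -> Omega -> R) (g : Omega -> R) :
  (forall n, measurable_fun setT (f n)) -> (forall n w, (0 <= f n w <= 1)%R) ->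
  (forall w, f ^~ w @ \oo --> g w) ->
  (fun n => \int[P]_w (f n w)%:E) @ \oo --> \int[P]_w (g w)%:E.
Proof.
move=> mf f01 fg.
have mg : measurable_fun setT g by apply: measurable_fun_cvg mf _ => w _; exact: fg.
have mEf n : measurable_fun setT (EFin \o f n) by exact/measurable_EFinP.
have mEg : measurable_fun setT (EFin \o g) by exact/measurable_EFinP.
have cv : {ae P, forall w, setT w -> (fun n => (EFin \o f n) w) @ \oo --> (EFin \o g) w}.
  by apply: aeW => w _; apply/fine_cvgP; split; [exact: nearW|exact: fg].
have i1 : P.-integrable setT (cst (1 : \bar R)).
  exact: (finite_measure_integrable_cst P 1%R measurableT).
have bnd : {ae P, forall w n, setT w -> `|(EFin \o f n) w| <= cst (1 : \bar R) w}.
  by apply: aeW => w n _; rewrite /= lee_fin ger0_norm; case/andP: (f01 n w).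
by have [] := dominated_convergence measurableT mEf mEg cv i1 bnd.
Qed.
End BoundedConvergence.

Lemma expeR_prod (R : realType) (I : Type) (s : seq I) (f : I -> \bar R) :
  (forall i, 0 <= f i) -> \prod_(i <- s) expeR (- f i) = expeR (- \sum_(i <- s) f i).
Proof.
move=> f0; elim: s => [|i s IH]; first by rewrite !big_nil oppe0 expeR0.
by rewrite !big_cons IH -expeRD -oppeD// ge0_adde_def// inE// sume_ge0.
Qed.

Section Laplace.
Import HBNNSimple.
Context {R : realType} {d} {Omega : measurableType d} (P : probability Omega R).
Context {dE} {E : measurableType dE} (nu : {measure set E -> \bar R}).
Context (X : nat -> Omega -> E) (ppX : poisson_process P X nu).

Let mX i : measurable_fun setT (X i). Proof. by case: ppX. Qed.

Let mXA i A : measurable A -> measurable (X i @^-1` A).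
Proof. by move=> mA; rewrite -[X in measurable X]setTI; exact: mX. Qed.

Lemma measurable_point_count A : measurable A ->
  measurable_fun setT (point_count R X A).
Proof.
move=> mA; apply: ge0_emeasurable_sum => // i _.
rewrite (_ : (fun w => _) = fun w => (\1_(X i @^-1` A) w)%:E).
  by apply/measurable_EFinP; apply: measurable_indic; exact: mXA.
by apply/funext => w; rewrite diracE indicE; congr (_%:R%:E); rewrite !inE.
Qed.

(** Exchanging the two products gives, in the limit, one factor for each A j that
depends on the number of points in A j only; these numbers are independent
Poisson variables. *)
Lemma laplace_disjoint n (c : 'I_n -> R) (A : 'I_n -> set E) :
  (forall j, (0 < c j <= 1)%R) -> (forall j, measurable (A j)) -> trivIset setT A ->
  (fun m => \int[P]_w (\prod_(i < m) \prod_(j < n) (1 - c j * (X i w \in A j)%:R))%:E)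
    @ \oo --> expeR (- \sum_(j < n) ((c j)%:E * nu (A j))).
Proof.
move=> c01 mA tA.
have H j w := thinned_product_cvg (fun i => X i w \in A j) (c01 j).
(* v j w is the limiting factor contributed by the points in A j. *)
pose v j w : R := sval (cid (H j w)).
have vP j w : [/\ (0 <= v j w <= 1)%R,
  (fun m => \prod_(i < m) (1 - c j * (X i w \in A j)%:R))%R @ \oo --> v j w &
  (v j w)%:E = \sum_(0 <= k <oo) (((1 - c j) ^+ k)%:E *
    (\1_[set w | point_count R X (A j) w = k%:R%:E] w)%:E)].
  rewrite /v; case: cid => x /= [x01 xl xE]; split => //; rewrite xE.
  apply: eq_eseriesr => k _; rewrite indicE.
  suff -> : (point_count R X (A j) w == k%:R%:E) =
    (w \in [set w | point_count R X (A j) w = k%:R%:E]) by [].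
  by apply/eqP/idP; rewrite inE.
have q01 j w m : (0 <= 1 - c j * (X m w \in A j)%:R <= 1)%R.
  have /andP[c0 c1] := c01 j; case: (_ \in _); rewrite ?mulr1 ?mulr0 ?subr0 ?ler01 ?lexx//.
  by rewrite subr_ge0 c1 lerBlDr lerDl ltW.
have mq j i : measurable_fun setT (fun w => 1 - c j * (X i w \in A j)%:R)%R.
  apply: measurable_funB => //; apply: measurable_funM => //.
  rewrite (_ : (fun w => _) = \1_(X i @^-1` A j)); first exact/measurable_indic/mXA.
  by apply/funext => w; rewrite indicE; congr (_%:R); rewrite !inE.
have -> : expeR (- \sum_(j < n) ((c j)%:E * nu (A j))) =
    \int[P]_w (\prod_(j < n) v j w)%:E.
  rewrite -expeR_prod; last by move=> j; rewrite mule_ge0// lee_fin ltW//; case/andP: (c01 j).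
  case: ppX => _ lawX indX.
  have mlev j k : measurable [set w | point_count R X (A j) w = k%:R%:E].
    have := measurable_point_count (mA j) measurableT (emeasurable_set1 k%:R%:E).
    by rewrite setTI.
  rewrite (@independent_expectation _ _ _ P _ _
    (fun j k => (1 - c j) ^+ k)%R
    (fun j k => [set w | point_count R X (A j) w = k%:R%:E]) v (indX n A mA tA))//.
  - apply: eq_bigr => j _.
    have [cj0 cj1] := andP (c01 j).
    rewrite -(poisson_law_thinned (c01 j) _ (measurable_point_count (mA j)) (lawX _ (mA j)))//.
    have -> : \int[P]_w (v j w)%:E = \int[P]_w \sum_(0 <= k <oo) (((1 - c j) ^+ k)%:E *
        (\1_[set w | point_count R X (A j) w = k%:R%:E] w)%:E).
      by apply: eq_integral => w _; case: (vP j w).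
    have q0 k : (0 <= (1 - c j) ^+ k)%R by rewrite exprn_ge0// subr_ge0.
    have m1 k : measurable_fun setT
        (fun w => (\1_[set w | point_count R X (A j) w = k%:R%:E] w)%:E : \bar R).
      by apply/measurable_EFinP; exact: measurable_indic.
    rewrite integral_nneseries//; last 2 first.
    + by move=> k; apply: emeasurable_funM.
    + by move=> k w _; rewrite mule_ge0// lee_fin// indicE.
    apply: eq_eseriesr => k _.
    by rewrite ge0_integralZl// ?lee_fin// integral_indic// setIT.
  - move=> j C [D mD <-]; rewrite setTI.
    have := measurable_point_count (mA j) measurableT mD.
    by rewrite setTI.
  - by move=> j k; exists [set k%:R%:E]; [exact: emeasurable_set1|rewrite setTI].
  - by move=> j k; rewrite exprn_ge0// subr_ge0; case/andP: (c01 j).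
  - by move=> j w; case: (vP j w).
  - by move=> j w; case: (vP j w).
  - exact: index_enum_uniq.
apply: bounded_convergence.
- by move=> m; apply: measurable_prod => i _; exact: measurable_prod.
- move=> m w; apply/andP; split.
    by apply: prodr_ge0 => i _; apply: prodr_ge0 => j _; case/andP: (q01 j w i).
  by apply: prodr_ile1 => i _; rewrite prodr_ge0 ?prodr_ile1// => j _; case/andP: (q01 j w i).
- move=> w; under eq_fun do rewrite exchange_big/=.
  apply: cvg_big => [|j _]; last by case: (vP j w).
  by move=> x; exact: mul_continuous.
Qed.

(** The level sets of a simple function at its nonzero values are finitely many
disjoint sets, which is the case already treated. *)
Lemma laplace_nnsfun (h : {nnsfun E >-> R}) : (forall x, (h x <= 1)%R) ->
  (fun m => \int[P]_w (\prod_(i < m) (1 - h (X i w)))%:E)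
    @ \oo --> expeR (- \int[nu]_x (h x)%:E).
Proof.
move=> h1.
pose s : seq R := [seq y <- finmap.enum_fset (fset_set (range h)) | y != 0%R].
have us : uniq s by rewrite filter_uniq// finmap.fset_uniq.
pose c (j : 'I_(size s)) := nth 0%R s j.
pose A j := h @^-1` [set c j].
have cs j : c j \in s by exact: mem_nth.
have sh y : (y \in s) = (y != 0%R) && (y \in range h).
  by rewrite mem_filter in_fset_set.
have c01 j : (0 < c j <= 1)%R.
  have := cs j; rewrite sh => /andP[c0]; rewrite inE => -[x _ hx].
  by rewrite lt_neqAle eq_sym c0/= -hx h1 fun_ge0.
have mA j : measurable (A j) by rewrite -[A j]setTI; exact: measurable_funP.
have tA : trivIset setT A.
  apply/trivIsetP => i j _ _ ij; apply/seteqP; split => // x [hi hj].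
  have /eqP : c i = c j by rewrite -[LHS]hi -[RHS]hj.
  rewrite nth_uniq// => /eqP/val_inj ij'.
  by move: ij; rewrite ij' eqxx.
have := laplace_disjoint c01 mA tA.
rewrite (_ : \sum_(j < size s) _ = \int[nu]_x (h x)%:E); last first.
  rewrite integralT_nnsfun sintegralE fsbig_finite//=.
  rewrite -(big_mkord xpredT (fun j => (nth 0%R s j)%:E * nu (h @^-1` [set nth 0%R s j]))).
  rewrite -(big_nth 0%R xpredT (fun y => y%:E * nu (h @^-1` [set y]))).
  rewrite big_filter big_mkcond/=; apply: eq_bigr => y _.
  by case: eqP => //= ->; rewrite mul0e.
rewrite (_ : (fun m => \int[P]_w _) =
  (fun m => \int[P]_w (\prod_(i < m) (1 - h (X i w)))%:E))//; apply/funext => m.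
apply: eq_integral => w _; congr _%:E; apply: eq_bigr => i _.
set x := X i w.
transitivity (\prod_(y <- s) (1 - y * (x \in h @^-1` [set y])%:R))%R.
  by rewrite (big_nth 0%R) big_mkord.
have inE' y : (x \in h @^-1` [set y]) = (h x == y).
  by apply/idP/eqP; rewrite inE.
have [hs|hNs] := boolP (h x \in s).
  rewrite (bigD1_seq (h x))//= inE' eqxx mulr1 big1 ?mulr1// => y yh.
  by rewrite inE' eq_sym (negbTE yh) mulr0 subr0.
have -> : h x = 0%R.
  apply/eqP; move: hNs; rewrite sh negb_and negbK => /orP[//|].
  by rewrite notin_setE => -[]; exists x.
rewrite big1_seq ?subr0// => y /= ys; rewrite inE'.
by case: eqP => [hy|_]; [move: hNs; rewrite hy ys|rewrite mulr0 subr0].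
Qed.

(** The truncated products decrease both in the number m of factors and in g. With
simple functions G n increasing to g, comparing the two limits squeezes the limit
in m between the exponentials of minus the integrals of g and of every G n. *)
Lemma laplace_functional (g : E -> R) : measurable_fun setT g ->
  (forall x, (0 <= g x <= 1)%R) ->
  (fun m => \int[P]_w (\prod_(i < m) (1 - g (X i w)))%:E)
    @ \oo --> expeR (- \int[nu]_x (g x)%:E).
Proof.
move=> mg g01.
have mEg : measurable_fun setT (EFin \o g) by exact/measurable_EFinP.
pose G : {nnsfun E >-> R}^nat := nnsfun_approx measurableT mEg.
have g0 x : setT x -> 0 <= (EFin \o g) x by move=> _; rewrite lee_fin; case/andP: (g01 x).
have Gg n x : (G n x <= g x)%R.
  by rewrite -lee_fin /G nnsfun_approxE; exact: (le_approx n g0).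
have G1 n x : (G n x <= 1)%R by apply: le_trans (Gg n x) _; case/andP: (g01 x).
have Gcvg x : EFin \o G^~ x @ \oo --> (EFin \o g) x by exact: cvg_nnsfun_approx.
pose a n m := \int[P]_w (\prod_(i < m) (1 - G n (X i w)))%:E.
pose b m := \int[P]_w (\prod_(i < m) (1 - g (X i w)))%:E.
have prod01 (f : E -> R) m w : (forall x, (0 <= f x <= 1)%R) ->
    (0 <= \prod_(i < m) (1 - f (X i w)) <= 1)%R.
  move=> f01; have q x : (0 <= 1 - f x <= 1)%R.
    by have /andP[f0 f1] := f01 x; rewrite subr_ge0 f1 lerBlDr lerDl.
  by rewrite prodr_ge0 ?prodr_ile1// => i _; case/andP: (q (X i w)).
have G01 n x : (0 <= G n x <= 1)%R by rewrite G1 fun_ge0.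
have mprod (f : E -> R) m : measurable_fun setT f ->
    measurable_fun setT (fun w => \prod_(i < m) (1 - f (X i w)))%R.
  move=> mf; apply: measurable_prod => i _; apply: measurable_funB => //.
  exact: measurableT_comp.
have amono (f : E -> R) : measurable_fun setT f -> (forall x, (0 <= f x <= 1)%R) ->
    {homo (fun m => \int[P]_w (\prod_(i < m) (1 - f (X i w)))%:E) : m n / (m <= n)%N >-> n <= m}.
  move=> mf f01; apply/nonincreasing_seqP => m; apply: ge0_le_integral => //.
  - by move=> w _; rewrite lee_fin; case/andP: (prod01 f m.+1 w f01).
  - by apply/measurable_EFinP; exact: mprod.
  - by apply/measurable_EFinP; exact: mprod.
  - move=> w _; rewrite lee_fin big_ord_recr/= ler_piMr//.
      by case/andP: (prod01 f m w f01).
    by case/andP: (f01 (X m w)) => f0 _; rewrite lerBlDr lerDl.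
have aL n : a n @ \oo --> expeR (- \int[nu]_x (G n x)%:E) by exact: laplace_nnsfun.
have ba n m : b m <= a n m.
  apply: ge0_le_integral => //.
  - by move=> w _; rewrite lee_fin; case/andP: (prod01 g m w g01).
  - by apply/measurable_EFinP; exact: mprod.
  - by apply/measurable_EFinP; exact: mprod.
  - move=> w _; rewrite lee_fin; apply: ler_prod => i _.
    by rewrite lerB// andbT subr_ge0; case/andP: (g01 (X i w)).
have ab m : (a ^~ m) @ \oo --> b m.
  apply: bounded_convergence.
  - by move=> n; exact: mprod.
  - by move=> n w; exact: prod01.
  - move=> w; apply: cvg_big => [|i _]; first by move=> x; exact: mul_continuous.
    apply: cvgB; first exact: cvg_cst.
    by have /fine_cvgP[] := Gcvg (X i w).
have IG n : \int[nu]_x (G n x)%:E <= \int[nu]_x (g x)%:E.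
  apply: ge0_le_integral => //.
  - by move=> x _; rewrite lee_fin.
  - by apply/measurable_EFinP.
  - by move=> x _; rewrite lee_fin.
have aLn n m : expeR (- \int[nu]_x (G n x)%:E) <= a n m.
  apply: (ecvg_le_near (aL n)); exists m => // k /= mk.
  exact: (amono _ _ (G01 n)).
have Lb m : expeR (- \int[nu]_x (g x)%:E) <= b m.
  apply: (ecvg_ge_near (ab m)); apply: nearW => n.
  by apply: le_trans (aLn n m); rewrite lee_expeR leeN2.
have bc : b @ \oo --> limn b by apply: ereal_nonincreasing_is_cvgn; exact: amono.
(* The lower bound is Lb; for the upper one the limit is compared with every G n. *)
suff <- : limn b = expeR (- \int[nu]_x (g x)%:E) by [].
apply/eqP; rewrite eq_le; apply/andP; split; last first.
  by apply: (ecvg_ge_near bc); exact: nearW.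
have lb0 : 0 <= limn b.
  apply: (ecvg_ge_near bc); apply: nearW => m; apply: le_trans (Lb m).
  exact: expeR_ge0.
have [y yE] := expeR_total lb0.
rewrite -yE lee_expeR leeNr.
have Ic : (fun n => \int[nu]_x (G n x)%:E) @ \oo --> \int[nu]_x (g x)%:E.
  have -> : \int[nu]_x (g x)%:E = \int[nu]_x (limn (fun n => (G n x)%:E)).
    by apply: eq_integral => x _; apply/esym/cvg_lim => //; exact: Gcvg.
  apply: cvg_monotone_convergence => //.
  - by move=> n; apply/measurable_EFinP.
  - by move=> n x _; rewrite lee_fin.
  - by move=> x _ m n mn; rewrite lee_fin; have /lefP := nd_nnsfun_approx measurableT mEg mn; exact.
apply: (ecvg_le_near Ic); apply: nearW => n.
rewrite leeNr -lee_expeR yE.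
apply: (ecvg_ge_near (aL n)); apply: nearW => m.
apply: le_trans (ba n m).
by apply: (ecvg_le_near bc); exists m => // k /= mk; exact: amono.
Qed.
End Laplace.

(** * Marked Poisson processes *)

Lemma measurable_prode (R : realType) d (S : measurableType d) (I : Type)
    (s : seq I) (f : I -> S -> \bar R) D :
  (forall i, measurable_fun D (f i)) -> measurable_fun D (fun w => \prod_(i <- s) f i w).
Proof.
move=> mf; elim: s => [|i s IH]; first by under eq_fun do rewrite big_nil; exact: measurable_cst.
by under eq_fun do rewrite big_cons; exact: emeasurable_funM.
Qed.

Lemma prode_update (R : realType) m j (jm : (j < m)%N) (c : \bar R) (F : nat -> \bar R) :
  \prod_(i < m) (if i == j :> nat then c else F i) =
  c * \prod_(i < m | i != Ordinal jm) F i.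
Proof.
rewrite (bigD1 (Ordinal jm))//= eqxx; congr (_ * _).
by apply: eq_bigr => i; rewrite -val_eqE/= => /negbTE ->.
Qed.

Section SetFunctionUnique.
Context {R : realType} {d} {S : measurableType d}.

(** What a Dynkin argument uses of a measure, for set functions that arise as
integrals of products. *)
Definition additive_on_measurable (F : set S -> \bar R) :=
  [/\ forall A, measurable A -> 0 <= F A,
      forall A, measurable A -> F A + F (~` A) = F setT &
      forall A : nat -> set S, (forall n, measurable (A n)) -> trivIset setT A ->
        F (\bigcup_n A n) = \sum_(0 <= n <oo) F (A n)].

Lemma additive_unique (F1 F2 : set S -> \bar R) (G : set (set S)) :
  @measurable _ S = <<s G>> -> setI_closed G ->
  additive_on_measurable F1 -> additive_on_measurable F2 ->
  F1 setT < +oo -> F1 setT = F2 setT -> (forall A, G A -> F1 A = F2 A) ->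
  forall A, measurable A -> F1 A = F2 A.
Proof.
move=> mG GI [F10 F1C F1U] [F20 F2C F2U] F1fin FT FG A mA.
have sA : <<s G>> A by rewrite -mG.
move: A sA {mA}; apply: dynkin_induction => //.
- move=> B mB eB.
  have Bfin : F1 B \is a fin_num.
    rewrite ge0_fin_numE ?F10//; apply: le_lt_trans F1fin.
    by rewrite -(F1C B mB) leeDl// F10//; exact: measurableC.
  have C1 := F1C B mB; have C2 := F2C B mB.
  have : F1 B + F1 (~` B) = F1 B + F2 (~` B) by rewrite C1 FT -C2 eB.
  by move=> /(congr1 (fun x => x - F1 B)); rewrite ![F1 B + _]addeC !addeK.
- move=> F mF tF eF; rewrite F1U// F2U//; apply: eq_eseriesr => n _; exact: eF.
Qed.

Lemma measure_additive (m : {measure set S -> \bar R}) : additive_on_measurable m.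
Proof.
split => // [A mA|A mA tA].
- rewrite -measureU//; last by rewrite setICr.
  + by rewrite setUv.
  + exact: measurableC.
- by rewrite measure_semi_bigcup//; exact: bigcupT_measurable.
Qed.
End SetFunctionUnique.

Section Marks.
Context {R : realType} {d2} {Omega2 : measurableType d2} (P2 : probability Omega2 R).
Context {dE} {E : measurableType dE} {dM} {M : measurableType dM}.
Context (X : nat -> Omega2 -> E) (V : nat -> Omega2 -> M).
Context {d} {Omega : measurableType d} (Q : probability Omega R).
Context (u : E * Omega -> \bar R) (v : E * Omega -> M).
Hypothesis mX : forall i, measurable_fun setT (X i).
Hypothesis mV : forall i, measurable_fun setT (V i).
Hypothesis mu_ : measurable_fun setT u.
Hypothesis mv : measurable_fun setT v.
Hypothesis u0 : forall z, 0 <= u z.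
Hypothesis ufin : forall z, u z \is a fin_num.
Hypothesis u1 : forall x, \int[Q]_y u (x, y) = 1.

(** The probability that a point at x together with its mark lies in G, when the
mark has the law of v (x, .) under the density u (x, .) with respect to Q. This is
the form in which tilted laws come: Q is the untilted law and u the weight. *)
Definition mark_prob (G : set (E * M)) (x : E) : \bar R :=
  \int[Q]_y (u (x, y) * (\1_G (x, v (x, y)))%:E).

Let K := mark_prob.

Hypothesis marksX : forall m (A : set Omega2) (C : nat -> set M),
  sigma_gen setT X A -> (forall i, measurable (C i)) ->
  P2 (A `&` \bigcap_(i in `I_m) [set w | C i (V i w)]) =
  \int[P2]_(w in A) \prod_(i < m) K (setT `*` C i) (X i w).

Let mpair : measurable_fun setT (fun z : E * Omega => (z.1, v z)).
Proof. by apply: measurable_fun_pair. Qed.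

Let mint G : measurable G ->
  measurable_fun setT (fun z : E * Omega => u z * (\1_G (z.1, v z))%:E).
Proof.
move=> mG; apply: emeasurable_funM => //; apply/measurable_EFinP.
rewrite (_ : (fun z => _) = \1_((fun z : E * Omega => (z.1, v z)) @^-1` G)).
  apply: measurable_indic; rewrite -[X in measurable X]setTI.
  exact: mpair.
by apply/funext => z; rewrite !indicE; congr (_%:R); rewrite !inE.
Qed.

Let i0 G z : 0 <= u z * (\1_G (z.1, v z))%:E.
Proof. by rewrite mule_ge0// lee_fin indicE. Qed.

Let minty G x : measurable G ->
  measurable_fun setT (fun y => u (x, y) * (\1_G (x, v (x, y)))%:E).
Proof.
move=> mG; have := mint mG; move/(@measurable_fun_pair2 _ _ _ _ _ _ _ x); exact.
Qed.

Lemma mark_prob_ge0 G x : 0 <= K G x.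
Proof. by apply: integral_ge0 => y _; exact: (i0 G (x, y)). Qed.

Lemma measurable_mark_prob G : measurable G -> measurable_fun setT (K G).
Proof.
move=> mG; have := @measurable_fun_fubini_tonelli_F _ _ _ _ _ Q
  (fun z : E * Omega => u z * (\1_G (z.1, v z))%:E).
by apply; [exact: mint|move=> z; exact: i0].
Qed.

Lemma mark_probT x : K setT x = 1.
Proof.
rewrite -(u1 x); apply: eq_integral => y _.
by rewrite indicE in_setT mule1.
Qed.

Lemma mark_probC G x : measurable G -> K G x + K (~` G) x = 1.
Proof.
move=> mG; rewrite -(u1 x) -ge0_integralD//.
- apply: eq_integral => y _; rewrite -ge0_muleDr ?lee_fin ?indicE//.
  by rewrite in_setC; case: (_ \in G); rewrite ?adde0 ?add0e mule1.
- exact: minty.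
- by apply: minty; exact: measurableC.
Qed.

Lemma mark_prob_le1 G x : measurable G -> K G x <= 1.
Proof. by move=> mG; rewrite -(mark_probC x mG) leeDl// mark_prob_ge0. Qed.

Lemma mark_prob_bigcup (G : nat -> set (E * M)) x : (forall n, measurable (G n)) ->
  trivIset setT G -> K (\bigcup_n G n) x = \sum_(0 <= n <oo) K (G n) x.
Proof.
move=> mG tG; rewrite /K /mark_prob -integral_nneseries//; last by move=> n; exact: minty.
apply: eq_integral => y _; set z := (x, v (x, y)).
rewrite indic_bigcup// -(fineK (ufin (x, y))) nneseriesZl//.
Qed.

Let S m (G : nat -> set (E * M)) := forall A : set Omega2, sigma_gen setT X A ->
  P2 (A `&` \bigcap_(i in `I_m) [set w | G i (X i w, V i w)]) =
  \int[P2]_(w in A) \prod_(i < m) K (G i) (X i w).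

Let sigma_gen_measurable A : sigma_gen setT X A -> measurable A.
Proof.
apply: smallest_sub; first exact: sigma_algebra_measurable.
by move=> B [i _ [C mC <-]]; exact: mX.
Qed.

Let mXV i G : measurable G -> measurable [set w | G (X i w, V i w)].
Proof.
move=> mG; have := @measurable_fun_pair _ _ _ _ _ _ _ _ (mX i) (mV i) measurableT G mG.
by rewrite setTI.
Qed.

Let mKX G i : measurable G -> measurable_fun setT (fun w => K G (X i w)).
Proof. by move=> mG; apply: measurableT_comp (measurable_mark_prob mG) (mX i). Qed.

(** Replacing one cylinder by a general set of points and marks: with the other
factors fixed both sides are measures in the j-th set, and they agree on
rectangles, since the constraint on the point can be moved into the event A. *)
Let marks_step m j (G : nat -> set (E * M)) : (j < m)%N ->
  (forall i, measurable (G i)) ->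
  (forall C, measurable C -> S m (fun i => if i == j then setT `*` C else G i)) ->
  S m G.
Proof.
move=> jm mG H A sA.
have mA := sigma_gen_measurable sA.
pose G' (D : set (E * M)) i := if i == j then D else G i.
have mG' D i : measurable D -> measurable (G' D i) by move=> mD; rewrite /G'; case: eqP.
pose B := A `&` \bigcap_(i in `I_m `\ j) [set w | G i (X i w, V i w)].
have mB : measurable B.
  apply: measurableI => //; apply: bigcap_measurableType => i _; exact: mXV.
have BE (A' : set Omega2) D : A' `&` \bigcap_(i in `I_m) [set w | G' D i (X i w, V i w)] =
    (A' `&` \bigcap_(i in `I_m `\ j) [set w | G i (X i w, V i w)])
    `&` [set w | D (X j w, V j w)].
  apply/seteqP; split => w.
    move=> [Aw Hw]; split; last by have := Hw j jm; rewrite /G'/= eqxx.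
    split => // i [/= im ij]; have := Hw i im; rewrite /G'/=.
    by case: eqP.
  move=> [[Aw Hw] Dw]; split => // i /= im; rewrite /G'.
  by case: eqP => [->//|ij]; apply: Hw.
pose k w := \prod_(i < m | i != Ordinal jm) K (G i) (X i w).
have k0 w : 0 <= k w by apply: prode_ge0 => i _; exact: mark_prob_ge0.
have kfin w : k w \is a fin_num.
  apply: prode_fin_num => i _; rewrite ge0_fin_numE ?mark_prob_ge0//.
  exact: le_lt_trans (mark_prob_le1 _ (mG i)) (ltry 1).
have mk : measurable_fun setT k.
  rewrite /k; under eq_fun do rewrite big_mkcond/=.
  by apply: measurable_prode => i; case: (i != Ordinal jm); [exact: mKX|exact: measurable_cst].
have kE D w : \prod_(i < m) K (G' D i) (X i w) = K D (X j w) * k w.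
  rewrite -(prode_update jm (K D (X j w)) (fun i => K (G i) (X i w))).
  by apply: eq_bigr => i _; rewrite /G'; case: (nat_of_ord i =P j) => [->|_]; reflexivity.
pose F1 D := P2 (B `&` [set w | D (X j w, V j w)]).
pose F2 D := \int[P2]_(w in A) (K D (X j w) * k w).
have GE : G = G' (G j) by apply/funext => i; rewrite /G'; case: eqP => [->|].
have t0 D w : 0 <= K D (X j w) * k w by rewrite mule_ge0// mark_prob_ge0.
have mt D : measurable D -> measurable_fun A (fun w => K D (X j w) * k w).
  by move=> mD; apply: measurable_funTS; apply: emeasurable_funM => //; exact: mKX.
suff HF : F1 (G j) = F2 (G j).
  rewrite GE BE -/B -/(F1 _) HF; apply: eq_integral => w _.
  by rewrite kE.
have rect C : measurable C -> F1 (setT `*` C) = F2 (setT `*` C).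
  move=> mC; have := H C mC A sA; rewrite BE -/B => e; rewrite /F1 e.
  by apply: eq_integral => w _; rewrite -kE.
have setTTE : [set: E * M] = setT `*` setT by rewrite setXTT.
apply: (@additive_unique _ _ _ F1 F2 [set A `*` B | A in measurable & B in measurable]).
- exact: measurable_prod_measurableType.
- move=> _ _ [C1 mC1 [D1 mD1 <-]] [C2 mC2 [D2 mD2 <-]].
  exists (C1 `&` C2); first exact: measurableI.
  exists (D1 `&` D2); first exact: measurableI.
  by rewrite setXI.
- have [_ mC mU] := measure_additive (mrestr P2 mB).
  have F1E D : F1 D = mrestr P2 mB [set w | D (X j w, V j w)].
    by rewrite /mrestr /F1 setIC.
  split => [D mD|D mD|D mD tD].
  + exact: measure_ge0.
  + by rewrite !F1E -(mC _ (mXV j mD)).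
  + transitivity (\sum_(0 <= n <oo) mrestr P2 mB [set w | D n (X j w, V j w)]); last first.
      by apply: eq_eseriesr => n _; rewrite F1E.
    rewrite F1E -mU; first by [].
    * by move=> n; exact: mXV.
    * move=> a b _ _ [w [Da Db]]; apply: (tD a b I I).
      by exists (X j w, V j w).
- split => [D mD|D mD|D mD tD].
  + by apply: integral_ge0 => w _; exact: t0.
  + rewrite /F2 -ge0_integralD//; last 2 first.
    * exact: mt.
    * by apply: mt; exact: measurableC.
    apply: eq_integral => w _; rewrite -ge0_muleDl ?mark_prob_ge0//.
    by rewrite mark_probC// mark_probT.
  + rewrite /F2 -integral_nneseries//; last by move=> n; exact: mt.
    apply: eq_integral => w _; rewrite mark_prob_bigcup//.
    rewrite muleC -(fineK (kfin w)) -nneseriesZl; last by move=> n _; exact: mark_prob_ge0.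
    by apply: eq_eseriesr => n _; rewrite muleC fineK.
- apply: le_lt_trans (ltry 1).
  exact: probability_le1 (measurableI _ _ mB (mXV j measurableT)).
- by rewrite setTTE rect.
- move=> _ [C mC [D mD <-]].
  have sA' : sigma_gen setT X (A `&` X j @^-1` C).
    apply: (@measurableI _ (g_sigma_algebraType
      (\bigcup_i preimage_set_system setT (X i) measurable))) => //.
    by apply: sub_sigma_algebra; exists j => //; exists C; rewrite ?setTI.
  have := H D mD _ sA'; rewrite BE => e.
  have -> : F1 (C `*` D) = P2 (A `&` X j @^-1` C `&`
      \bigcap_(i in `I_m `\ j) [set w | G i (X i w, V i w)] `&`
      [set w | ([set: E] `*` D) (X j w, V j w)]).
    rewrite /F1 /B; congr (P2 _); apply/seteqP; split => w /=.
      by move=> [[Aw Hw] [Cw Dw]]; do !split.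
    by move=> [[[Aw Cw] Hw] [_ Dw]]; do !split.
  rewrite e integral_mkcondr; apply: eq_integral => w _.
  rewrite patchE kE.
  have -> : K (C `*` D) (X j w) = (\1_C (X j w))%:E * K (setT `*` D) (X j w).
    rewrite /K /mark_prob -ge0_integralZl//; last first.
      by apply: minty; exact: measurableX.
    apply: eq_integral => y _; rewrite muleCA -EFinM; congr (_ * _%:E).
    rewrite !indicE -natrM mulnb; congr ((nat_of_bool _)%:R).
    by apply/idP/andP; rewrite !inE/=; [move=> []|move=> [? []]].
  rewrite indicE; have [Cw|Cw] := boolP (X j w \in C).
    by rewrite mem_set ?mul1e//; exact: set_mem.
  by rewrite memNset ?mul0e// => Cw'; move: Cw; rewrite notin_setE; apply.
- exact: mG.
Qed.

(** The hypothesis on the marks constrains the marks alone; here each constraint may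
bear on the point and its mark jointly. The sets are replaced one after the other,
j counting those that are already general. *)
Lemma marks_jointly m (G : nat -> set (E * M)) :
  (forall i, measurable (G i)) -> S m G.
Proof.
suff T j : forall G : nat -> set (E * M), (forall i, measurable (G i)) ->
    (forall i, (j <= i)%N -> (i < m)%N -> exists2 C, measurable C & G i = setT `*` C) ->
    S m G.
  move=> mG; apply: (T m) => // i mi im.
  by move: mi; rewrite leqNgt im.
elim: j => [|j IH] {}G mG GC.
  have /boolp.choice[C CP] : forall i, exists C : set M,
      measurable C /\ ((i < m)%N -> G i = setT `*` C).
    move=> i; have [im|im] := ltnP i m; last by exists setT.
    by have [C mC GE] := GC i isT im; exists C.
  move=> A sA; have mC i : measurable (C i) by case: (CP i).
  have GE i : (i < m)%N -> G i = setT `*` C i by case: (CP i).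
  rewrite (_ : _ `&` _ = A `&` \bigcap_(i in `I_m) [set w | C i (V i w)]).
    rewrite (marksX m sA mC); apply: eq_integral => w _; apply: eq_bigr => i _.
    by rewrite (GE i (ltn_ord i)).
  congr (_ `&` _); apply: eq_bigcapr => i /= im; rewrite (GE i im).
  by apply/seteqP; split => w //= [].
have [jm|mj] := ltnP j m; last first.
  by apply: IH => // i ji im; move: (leq_ltn_trans mj (leq_ltn_trans ji im)); rewrite ltnn.
apply: (marks_step jm mG) => C mC; apply: IH => [i|i ji im].
  by case: eqP => // _; exact: measurableX.
case: eqP => [_|/eqP ij]; first by exists C.
by apply: GC => //; rewrite ltn_neqAle eq_sym ij.
Qed.

(** The points whose mark is bad form an independent thinning with retention
probability g = mark_prob (~` G), and the event is that none is retained. Given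
the points, the first m are all good with probability prod_(i < m) (1 - g (X i)),
so this is the Laplace functional at g. *)
Lemma marked_poisson_void (nu : {measure set E -> \bar R}) (G : set (E * M)) :
  poisson_process P2 X nu -> measurable G ->
  P2 [set w | forall i, G (X i w, V i w)] =
  expeR (- \int[nu]_x mark_prob (~` G) x).
Proof.
move=> ppX mG.
have mGC : measurable (~` G) by exact: measurableC.
have KGfin x : K (~` G) x \is a fin_num.
  by rewrite ge0_fin_numE ?mark_prob_ge0//; exact: le_lt_trans (mark_prob_le1 _ mGC) (ltry 1).
pose g x : R := fine (K (~` G) x).
have gE x : (g x)%:E = K (~` G) x by rewrite fineK.
have mg : measurable_fun setT g.
  apply/measurable_EFinP; rewrite (_ : _ \o _ = K (~` G)); first exact: measurable_mark_prob.
  by apply/funext => x /=.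
have g01 x : (0 <= g x <= 1)%R.
  by rewrite -!lee_fin gE mark_prob_ge0 mark_prob_le1.
have lap := laplace_functional ppX mg g01.
have e m : P2 (\bigcap_(i in `I_m) [set w | G (X i w, V i w)]) =
    \int[P2]_w (\prod_(i < m) (1 - g (X i w)))%:E.
  have := @marks_jointly m (fun=> G) (fun=> mG) setT (@measurableT _ (g_sigma_algebraType
      (\bigcup_i preimage_set_system setT (X i) measurable))).
  rewrite setTI => ->; apply: eq_integral => w _.
  rewrite -prodEFin; apply: eq_bigr => i _.
  rewrite EFinB gE -(mark_probC (X i w) mG) addeK//.
have nonincr : nonincreasing_seq (fun m => \bigcap_(i in `I_m) [set w | G (X i w, V i w)]).
  move=> a b ab; apply/subsetPset; move=> w Hw i /= ia.
  exact: Hw (leq_trans ia ab).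
have mD m : measurable (\bigcap_(i in `I_m) [set w | G (X i w, V i w)]).
  by apply: bigcap_measurableType => i _; exact: mXV.
have c : (fun m => P2 (\bigcap_(i in `I_m) [set w | G (X i w, V i w)])) @ \oo -->
   P2 (\bigcap_m \bigcap_(i in `I_m) [set w | G (X i w, V i w)]).
  apply: nonincreasing_cvg_mu => //.
  - exact: le_lt_trans (probability_le1 _ (mD 0%N)) (ltry 1).
  - exact: bigcapT_measurable.
have -> : [set w | forall i, G (X i w, V i w)] =
    \bigcap_m \bigcap_(i in `I_m) [set w | G (X i w, V i w)].
  apply/seteqP; split => w /=; first by move=> H m _ i _; exact: H.
  by move=> H i; apply: (H i.+1 I i) => /=.
have <- : \int[nu]_x (g x)%:E = \int[nu]_x mark_prob (~` G) x.
  by apply: eq_integral => x _; exact: gE.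
move: c; rewrite (_ : (fun m => P2 _) = (fun m =>
    \int[P2]_w (\prod_(i < m) (1 - g (X i w)))%:E)); last exact/funext.
by move=> c; apply: (cvg_unique _ c lap).
Qed.

End Marks.

(** * Sampling an integral along a deterministic sequence *)

Section GreedySampling.
Context {R : realType} {dT} {T : measurableType dT} {d} {Omega : measurableType d}.
Context (rho : {finite_measure set T -> \bar R}) (Q : {finite_measure set Omega -> \bar R}).
Context (phi : T * Omega -> R) (B : R).
Hypothesis mphi : measurable_fun setT phi.
Hypothesis phi0 : forall z, (0 <= phi z)%R.
Hypothesis phiB : forall z, (phi z <= B)%R.

Let m := fine (rho setT).
Let q := fine (Q setT).
Let J w := (fine (\int[rho]_s (phi (s, w))%:E) / m)%R.
Hypothesis m0 : (0 < m)%R.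

Let mE : m%:E = rho setT. Proof. by rewrite fineK// fin_num_measure. Qed.
Let qE : q%:E = Q setT. Proof. by rewrite fineK// fin_num_measure. Qed.
Let int_rho (c : R) : \int[rho]_s c%:E = (c * m)%:E.
Proof. by rewrite integral_cst// EFinM mE. Qed.
Let int_Q (c : R) : \int[Q]_w c%:E = (c * q)%:E.
Proof. by rewrite integral_cst// EFinM qE. Qed.
Let q0 : (0 <= q)%R. Proof. by rewrite -lee_fin qE. Qed.

Let mphi1 w : measurable_fun setT (fun s => phi (s, w)).
Proof. exact: measurable_fun_pair1. Qed.

Let mphi2 s : measurable_fun setT (fun w => phi (s, w)).
Proof. exact: measurable_fun_pair2. Qed.

Let intphi_ge0 w : 0 <= \int[rho]_s (phi (s, w))%:E.
Proof. by apply: integral_ge0 => s _; rewrite lee_fin. Qed.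

Let intphi_le w : \int[rho]_s (phi (s, w))%:E <= (B * m)%:E.
Proof.
rewrite -int_rho; apply: ge0_le_integral => //.
- by move=> s _; rewrite lee_fin.
- exact/measurable_EFinP.
- by move=> s _; rewrite lee_fin.
Qed.

Let intphi_fin w : \int[rho]_s (phi (s, w))%:E \is a fin_num.
Proof. by rewrite ge0_fin_numE//; exact: le_lt_trans (intphi_le w) (ltry _). Qed.

Let intphiE w : \int[rho]_s (phi (s, w))%:E = (J w * m)%:E.
Proof. by rewrite /J divfK ?fineK// gt_eqF. Qed.

Let J01 w : (0 <= J w <= B)%R.
Proof.
apply/andP; split; first by rewrite divr_ge0 ?fine_ge0// ltW.
by rewrite /J ler_pdivrMr// -lee_fin fineK.
Qed.

Let mJ : measurable_fun setT J.
Proof.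
apply: measurable_funM => //; apply: measurableT_comp; first exact: fine_measurable.
apply: (@measurable_fun_fubini_tonelli_G _ _ _ _ _ rho (fun z => (phi z)%:E)).
- exact/measurable_EFinP.
- by move=> z; rewrite lee_fin.
Qed.

(** For a random s with law rho / m the increment phi (s, w) - J w is centred with
variance at most B^2, so the mean of the square is at most a^2 + B^2. *)
Let variance_bound w (a : R) :
  \int[rho]_s (((a + phi (s, w) - J w) ^+ 2)%:E) <= (m * (a ^+ 2 + B ^+ 2))%:E.
Proof.
(* Expand the square and use phi^2 <= B phi to stay affine in phi. *)
pose c0 := ((a - J w) ^+ 2)%R; pose k := (2 * (a - J w) + B)%R.
have iphi : rho.-integrable setT (fun s => (phi (s, w))%:E).
  apply/integrableP; split; first exact/measurable_EFinP.
  under eq_integral do rewrite gee0_abs ?lee_fin//.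
  exact: le_lt_trans (intphi_le w) (ltry _).
have ic : rho.-integrable setT (fun _ : T => c0%:E).
  exact: (finite_measure_integrable_cst rho c0 measurableT).
apply: (@le_trans _ _ (\int[rho]_s (c0%:E + k%:E * (phi (s, w))%:E))).
  apply: ge0_le_integral => //.
  - by move=> s _; rewrite lee_fin sqr_ge0.
  - apply/measurable_EFinP; apply: measurable_funX.
    by apply: measurable_funB => //; apply: measurable_funD.
  - apply: emeasurable_funD => //; apply: emeasurable_funM => //.
    exact/measurable_EFinP.
  - move=> s _; rewrite -EFinM -EFinD lee_fin /c0 /k.
    have := phi0 (s, w); have := phiB (s, w); set p := phi _ => pB p0.
    have : (0 <= p * (B - p))%R by rewrite mulr_ge0// subr_ge0.
    nra.
rewrite integralD//; last exact: integrableZl.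
rewrite integralZl// int_rho intphiE -!EFinM -EFinD lee_fin /c0 /k.
have /andP[] := J01 w; set j := J w => j0 jB.
have : (0 <= m * (B * (B - j)))%R by rewrite mulr_ge0 ?(ltW m0)// mulr_ge0// ?subr_ge0// (le_trans j0).
have : (0 <= m * (j ^+ 2))%R by rewrite mulr_ge0 ?(ltW m0)// sqr_ge0.
nra.
Qed.

(** Averaged over s the increase of the mean square error is at most B^2 q, so some
s does no worse than B^2 q + 1; the spare 1 avoids asking that the average be
attained. *)
Lemma greedy_sample (D : Omega -> R) : measurable_fun setT D -> exists s,
  \int[Q]_w ((D w + phi (s, w) - J w) ^+ 2)%:E <=
  \int[Q]_w ((D w) ^+ 2)%:E + (B ^+ 2 * q + 1)%:E.
Proof.
move=> mD; apply: contrapT => /forallNP H.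
have D0 : 0 <= \int[Q]_w ((D w) ^+ 2)%:E by apply: integral_ge0 => w _; rewrite lee_fin sqr_ge0.
pose f (z : T * Omega) := (((D z.2 + phi z - J z.2) ^+ 2)%R)%:E.
have f0 z : 0 <= f z by rewrite lee_fin sqr_ge0.
have mf : measurable_fun setT f.
  apply/measurable_EFinP; apply: measurable_funX; apply: measurable_funB.
    by apply: measurable_funD => //; apply: measurableT_comp.
  exact: measurableT_comp.
have Hgt s : \int[Q]_w ((D w) ^+ 2)%:E + (B ^+ 2 * q + 1)%:E < \int[Q]_w f (s, w).
  by rewrite ltNge; apply/negP; exact: H.
have D2fin : \int[Q]_w ((D w) ^+ 2)%:E \is a fin_num.
  rewrite ge0_fin_numE// ltey; apply/eqP => e.
  by have := Hgt point; rewrite e addye// ltNge leey.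
pose c := fine (\int[Q]_w ((D w) ^+ 2)%:E).
have cE : \int[Q]_w ((D w) ^+ 2)%:E = c%:E by rewrite fineK.
have lo : (m * (c + (B ^+ 2 * q + 1)))%:E <= \int[rho]_s \int[Q]_w f (s, w).
  rewrite mulrC -int_rho; apply: ge0_le_integral => //.
  - move=> s _; rewrite lee_fin addr_ge0 ?fine_ge0//.
    by rewrite addr_ge0// mulr_ge0// sqr_ge0.
  - exact: measurable_fun_fubini_tonelli_F.
  - by move=> s _; apply: ltW; rewrite EFinD -cE; exact: Hgt.
have hi : \int[rho]_s \int[Q]_w f (s, w) <= (m * (c + B ^+ 2 * q))%:E.
  rewrite (@fubini_tonelli _ _ _ _ _ rho Q f mf f0).
  apply: (@le_trans _ _ (\int[Q]_w (m%:E * (((D w) ^+ 2)%:E + (B ^+ 2)%:E)))).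
    apply: ge0_le_integral => //.
    - by move=> w _; apply: integral_ge0.
    - exact: measurable_fun_fubini_tonelli_G.
    - apply: emeasurable_funM => //; apply: emeasurable_funD => //.
      by apply/measurable_EFinP; exact: measurable_funX.
    - move=> w _; apply: le_trans (variance_bound w (D w)) _.
      by rewrite EFinM EFinD.
  rewrite ge0_integralZl//; last 3 first.
  - apply: emeasurable_funD => //; apply/measurable_EFinP; exact: measurable_funX.
  - by move=> w _; rewrite -EFinD lee_fin addr_ge0// sqr_ge0.
  - by rewrite lee_fin ltW.
  rewrite ge0_integralD//; last 3 first.
  - by move=> w _; rewrite lee_fin sqr_ge0.
  - by apply/measurable_EFinP; exact: measurable_funX.
  - by move=> w _; rewrite lee_fin sqr_ge0.
  by rewrite cE int_Q -EFinD -EFinM.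
have := le_trans lo hi; rewrite lee_fin ler_pM2l// lerD2l.
by rewrite gerDl ler10.
Qed.

(** Adding one sample at a time keeps the mean square of the centred sum of N terms
below a multiple of N. Along N = 2^(k+1) the squared relative errors are
summable, so they tend to 0 almost everywhere. *)
Lemma greedy_lln : exists s : nat -> T, {ae Q, forall w,
  (fun k => (m / (2 ^ (k + 1))%:R * \sum_(l < 2 ^ (k + 1)) phi (s l, w))%R%:E) @ \oo
    --> \int[rho]_s (phi (s, w))%:E}.
Proof.
have /boolp.choice[nxt nxtP] : forall D : Omega -> R, exists s, measurable_fun setT D ->
    \int[Q]_w ((D w + phi (s, w) - J w) ^+ 2)%:E <=
    \int[Q]_w ((D w) ^+ 2)%:E + (B ^+ 2 * q + 1)%:E.
  move=> D; have [mD|nmD] := pselect (measurable_fun setT D); last by exists point.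
  by have [s sP] := greedy_sample mD; exists s.
pose Dl := fix Dl (N : nat) : Omega -> R := if N is N'.+1 then
  fun w => (Dl N' w + phi (nxt (Dl N'), w) - J w)%R else fun=> 0%R.
pose s N := nxt (Dl N).
pose K := (B ^+ 2 * q + 1)%R.
have K0 : (0 <= K)%R by rewrite addr_ge0// mulr_ge0// sqr_ge0.
have mDl N : measurable_fun setT (Dl N).
  elim: N => [|N IH] //=; apply: measurable_funB => //; exact: measurable_funD.
have DlE N w : Dl N w = (\sum_(l < N) phi (s l, w) - N%:R * J w)%R.
  elim: N => [|N IH]; first by rewrite big_ord0 mul0r subr0.
  by rewrite /= big_ord_recr/= IH /s -natr1 mulrDl mul1r; lra.
have VN N : \int[Q]_w ((Dl N w) ^+ 2)%:E <= (N%:R * K)%:E.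
  elim: N => [|N IH].
    by rewrite mul0r integral0_eq// => w _; rewrite /= expr0n.
  apply: le_trans (nxtP _ (mDl N)) _.
  by rewrite -natr1 mulrDl mul1r [leRHS]EFinD leeD.
pose sz k : nat := (2 ^ (k + 1))%N.
have sz0 k : (0 < (sz k)%:R :> R)%R by rewrite ltr0n expn_gt0.
pose e k w : R := ((Dl (sz k) w / (sz k)%:R) ^+ 2)%R.
have e0 k w : 0 <= (e k w)%:E by rewrite lee_fin sqr_ge0.
have me k : measurable_fun setT (fun w => (e k w)%:E).
  by apply/measurable_EFinP; apply: measurable_funX; exact: measurable_funM.
have Ve k : \int[Q]_w (e k w)%:E <= (K / (sz k)%:R)%:E.
  under eq_integral => w _ do rewrite /e exprMn mulrC EFinM.
  have mD2 : measurable_fun setT (fun w => ((Dl (sz k) w) ^+ 2)%:E).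
    by apply/measurable_EFinP; exact: measurable_funX.
  have D20 w : setT w -> 0 <= ((Dl (sz k) w) ^+ 2)%:E by rewrite lee_fin sqr_ge0.
  have z0 : 0 <= (((sz k)%:R^-1) ^+ 2)%:E :> \bar R by rewrite lee_fin sqr_ge0.
  rewrite (ge0_integralZl Q measurableT mD2 D20 z0).
  apply: (@le_trans _ _ ((((sz k)%:R^-1) ^+ 2)%:E * ((sz k)%:R * K)%:E)).
    by apply: lee_pmul; rewrite ?lee_fin ?sqr_ge0//; apply: integral_ge0 => w _; rewrite lee_fin sqr_ge0.
  rewrite -EFinM lee_fin; have := sz0 k; set z := _%:R => zgt0.
  suff -> : (z^-1 ^+ 2 * (z * K) = K / z)%R by [].
  by field; rewrite gt_eqF.
have sumfin : \int[Q]_w (\sum_(0 <= k <oo) (e k w)%:E) < +oo.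
  rewrite integral_nneseries//.
  apply: (@le_lt_trans _ _ (\sum_(0 <= k <oo) (K / (sz k)%:R)%:E)).
    apply: lee_nneseries => k *; last exact: Ve.
    by apply: integral_ge0 => w _.
  have := @cvg_geometric_eseries_half R K 0.
  by move=> /cvg_lim; rewrite /eseries/= /sz => ->//; exact: ltry.
have aefin : {ae Q, forall w, setT w -> \sum_(0 <= k <oo) (e k w)%:E \is a fin_num}.
  apply: integrable_ae => //; apply/integrableP; split.
    exact: ge0_emeasurable_sum.
  by under eq_integral do rewrite gee0_abs ?nneseries_ge0//.
exists s; apply: filterS aefin => w /(_ I) fw.
have ecvg : (fun k => (e k w)%:E) @ \oo --> 0.
  have tail := @nneseries_tail_cvg _ (fun k => (e k w)%:E) xpredT.
  have {}tail : \sum_(N <= k <oo) (e k w)%:E @[N --> \oo] --> 0.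
    by apply: tail => //; rewrite -ge0_fin_numE// nneseries_ge0.
  apply: (squeeze_cvge _ (cvg_cst 0) tail).
  apply: nearW => k; rewrite e0/=.
  have := @nneseries_lim_ge R (fun k => (e k w)%:E) xpredT k k.+1.
  by rewrite big_nat1; apply.
have Dcvg : (fun k => Dl (sz k) w / (sz k)%:R)%R @ \oo --> 0%R.
  have /fine_cvgP[_ er] := ecvg.
  have : (fun k => Num.sqrt (e k w)) @ \oo --> Num.sqrt 0%R.
    apply: (@cvg_comp _ _ _ _ (@Num.sqrt R) _ _ _ er).
    exact: sqrt_continuous.
  rewrite sqrtr0 => H; apply: norm_cvg0; move: H.
  by under eq_fun do rewrite /e sqrtr_sqr.
rewrite intphiE; apply/fine_cvgP; split; first exact: nearW.
rewrite /comp/=.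
have -> : (fun k => m / (2 ^ (k + 1))%:R * \sum_(l < 2 ^ (k + 1)) phi (s l, w))%R =
    (fun k => m * (Dl (sz k) w / (sz k)%:R) + J w * m)%R.
  apply/funext => k; rewrite DlE -/(sz k).
  have := sz0 k; set z := _%:R => z0.
  by field; rewrite gt_eqF.
rewrite -[X in _ --> X]add0r -[X in _ --> (X + _)%R](mulr0 m).
by apply: cvgD; [apply: cvgM; [exact: cvg_cst|exact: Dcvg]|exact: cvg_cst].
Qed.

End GreedySampling.

(** * Path space and integrals along paths *)

Definition path_generators (R : realType) (T : Type) : set (set (T -> \bar R)) :=
  \bigcup_i preimage_set_system setT (fun f : T -> \bar R => f i) measurable.

(** Functions from T to the extended reals with the product sigma-field, whose
measurable sets are the path events. *)
Notation path_space R T := (g_sigma_algebraType (@path_generators R T)).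

Section PathSpace.
Context {R : realType} {T : Type}.

Lemma measurable_eval (t : T) :
  measurable_fun setT (fun f : path_space R T => (f : T -> \bar R) t).
Proof.
move=> _ B mB; apply: sub_sigma_algebra; exists t => //; exists B => //.
Qed.

Lemma measurable_to_path d (S : measurableType d) (F : S -> T -> \bar R) :
  (forall t, measurable_fun setT (F ^~ t)) ->
  measurable_fun setT (F : S -> path_space R T).
Proof.
move=> mF; apply: (@measurability _ _ _ (path_space R T) _ _ (@path_generators R T)) => //.
move=> _ [_ [t _ [C mC <-]] <-]; rewrite setTI.
have := mF t measurableT C mC.
by rewrite !setTI.
Qed.
End PathSpace.

Section FiniteDominating.
Context {R : realType} {d} {S : measurableType d}.

(** Only null sets matter for an almost everywhere statement, and an s-finite measure
has the same null sets as a suitably weighted sum of its finite components. *)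
Lemma finite_dominating (Q : {sfinite_measure set S -> \bar R}) :
  exists Q' : {finite_measure set S -> \bar R},
    forall A, measurable A -> Q' A = 0 -> Q A = 0.
Proof.
pose Qn := sfinite_measure_seq Q.
have c0 n : (0 <= (2 ^ (n + 1))%:R^-1 / (1 + fine (Qn n setT)) :> R)%R.
  by rewrite divr_ge0// addr_ge0// fine_ge0.
pose c n : {nonneg R} := NngNum (c0 n).
pose Q0 : {measure set S -> \bar R} := mseries (fun n => mscale (c n) (Qn n)) 0.
have Q0fin : Q0 setT < +oo.
  apply: (@le_lt_trans _ _ (\sum_(0 <= k <oo) (1 / (2 ^ (k + 1))%:R)%:E)); last first.
    have := @cvg_geometric_eseries_half R 1 0.
    by move=> /cvg_lim; rewrite /eseries/= => ->//; exact: ltry.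
  apply: lee_nneseries => [n _ _|n _]; first exact: measure_ge0.
  rewrite [leLHS](_ : _ = ((2 ^ (n + 1))%:R^-1 / (1 + fine (Qn n setT)) *
    fine (Qn n setT))%:E); last by rewrite EFinM fineK// fin_num_measure.
  rewrite lee_fin.
  have : (0 <= fine (Qn n setT))%R by rewrite fine_ge0.
  set z := fine _ => z0; rewrite div1r -mulrA ler_piMr// mulrC ler_pdivrMr ?ltr_wpDr//.
  by rewrite mul1r lerDr.
exists (mfrestr measurableT Q0fin) => A mA Q'A0.
have QA0 : Q0 A = 0 by rewrite -(setIT A).
rewrite (sfinite_measure_seqP Q mA) /mseries eseries0// => n _ _.
have : (c n)%:num%:E * Qn n A = 0.
  apply/eqP; rewrite eq_le mule_ge0// ?lee_fin// andbT -QA0.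
  have := @nneseries_lim_ge R (fun n => mscale (c n) (Qn n) A) xpredT 0 n.+1.
  rewrite big_nat_recr//= => H; apply: le_trans (H _) => //.
  by rewrite leeDr// sume_ge0.
move=> /eqP; rewrite mule_eq0 => /orP[|/eqP//].
rewrite eqe mulf_eq0 !invr_eq0 pnatr_eq0 expn_eq0/= => /eqP e.
have : (0 < 1 + fine (Qn n setT))%R by rewrite ltr_wpDr// fine_ge0.
by rewrite e ltxx.
Qed.
End FiniteDominating.

Section PathIntegral.
Context {R : realType} {dT} {T : measurableType dT} {d} {Omega : measurableType d}.
Context (Y : T * Omega -> \bar R).
Hypothesis mY : measurable_fun setT Y.
Hypothesis Y0 : forall z, 0 <= Y z.

Let truncE (y : \bar R) (M : nat) : 0 <= y ->
  (fine (mine y M.+1%:R%:E))%:E = mine y M.+1%:R%:E.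
Proof.
move=> y0; rewrite fineK// ge0_fin_numE ?le_min ?y0//= ?lee_fin//.
by rewrite gt_min ltry orbT.
Qed.

(** Truncating Y at M + 1 makes it bounded, so that its integral is the limit of
averages over the sampled coordinates; the functional reads these coordinates and
lets M tend to infinity. Upper limits keep it measurable on all paths. *)
Lemma path_integral_finite (rho : {finite_measure set T -> \bar R})
    (Q : {finite_measure set Omega -> \bar R}) :
  exists Phi : path_space R T -> \bar R, measurable_fun setT Phi /\
    {ae Q, forall w, Phi (fun s => Y (s, w)) = \int[rho]_s Y (s, w)}.
Proof.
have mYw w : measurable_fun setT (fun s => Y (s, w)) by exact: measurable_fun_pair1.
have [rho0|rhoN0] := eqVneq (rho setT) 0.
  exists (fun=> 0); split => //; apply: aeW => w.
  by rewrite null_set_integral.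
pose m := fine (rho setT).
have m0 : (0 < m)%R.
  by rewrite fine_gt0// lt_neqAle eq_sym rhoN0 measure_ge0/= -ge0_fin_numE// fin_num_measure.
pose phi (M : nat) z : R := fine (mine (Y z) M.+1%:R%:E).
have phiE M z : (phi M z)%:E = mine (Y z) M.+1%:R%:E by exact: truncE.
have mphi M : measurable_fun setT (phi M).
  by apply: measurableT_comp => //; apply: measurable_mine.
have phi0 M z : (0 <= phi M z)%R by rewrite -lee_fin phiE le_min Y0 lee_fin ler0n.
have phiB M z : (phi M z <= M.+1%:R)%R by rewrite -lee_fin phiE ge_min lexx orbT.
have /boolp.choice[s sP] M := greedy_lln Q (mphi M) (phi0 M) (phiB M) m0.
pose avg M k (f : path_space R T) : \bar R :=
  (m / (2 ^ (k + 1))%:R *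
    \sum_(l < 2 ^ (k + 1)) fine (mine ((f : T -> \bar R) (s M l)) M.+1%:R%:E))%R%:E.
pose Psi M (f : path_space R T) := limn_esup (avg M ^~ f).
exists (fun f => limn_esup (Psi ^~ f)); split.
  apply: measurable_fun_limn_esup => M; apply: measurable_fun_limn_esup => k.
  apply/measurable_EFinP; apply: measurable_funM => //.
  apply: measurable_sum => l; apply: measurableT_comp => //.
  apply: measurable_mine => //; exact: measurable_eval.
apply: filterS (ae_foralln sP) => w sw.
have PsiE M : Psi M (fun s => Y (s, w)) = \int[rho]_s mine (Y (s, w)) M.+1%:R%:E.
  under [RHS]eq_integral do rewrite -phiE.
  rewrite /Psi is_cvg_limn_esupE; first exact: (cvg_lim _ (sw M)).
  by apply/cvg_ex; eexists; exact: (sw M).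
under eq_fun do rewrite PsiE.
have lim : (fun M => \int[rho]_s mine (Y (s, w)) M.+1%:R%:E) @ \oo --> \int[rho]_s Y (s, w).
  have -> : \int[rho]_s Y (s, w) = \int[rho]_s (limn (fun M => mine (Y (s, w)) M.+1%:R%:E)).
    apply: eq_integral => t _; apply/esym/cvg_lim => //.
    have := Y0 (t, w); case: (Y (t, w)) => [r r0| _|//].
      apply: cvg_near_cst; exists (Num.trunc `|r|) => // n /= rn.
      apply/min_idPl; rewrite lee_fin; apply: le_trans (ler_norm _) _.
      by apply: ltW; apply: lt_le_trans (truncnS_gt _) _; rewrite ler_nat.
    rewrite (_ : (fun M => _) = fun M => M.+1%:R%:E); last first.
      by apply/funext => M; rewrite min_r// leey.
    apply/cvgeryP; rewrite (cvg_shiftS (fun n => n%:R : R)).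
    exact: cvgr_idn.
  apply: cvg_monotone_convergence => //.
  - by move=> n; apply: measurable_mine.
  - by move=> n t _; rewrite le_min Y0 lee_fin ler0n.
  - move=> t _ a b ab; rewrite le_min ge_min lexx/= ge_min.
    by rewrite [X in _ || X]lee_fin ler_nat ltnS ab orbT.
rewrite is_cvg_limn_esupE; first exact: (cvg_lim _ lim).
by apply/cvg_ex; eexists; exact: lim.
Qed.

(** Integration along a path need not be measurable on path space; for almost every
w it is nevertheless given by one measurable functional of the path Y (., w). *)
Theorem path_integral_functional (mu : {sfinite_measure set T -> \bar R})
    (Q : {sfinite_measure set Omega -> \bar R}) :
  exists Phi : path_space R T -> \bar R, measurable_fun setT Phi /\
    {ae Q, forall w, Phi (fun s => Y (s, w)) = \int[mu]_s Y (s, w)}.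
Proof.
have [Q' Q'P] := finite_dominating Q.
pose mun := sfinite_measure_seq mu.
have /boolp.choice[Phi PhiP] n := path_integral_finite (mun n) Q'.
exists (fun f => \sum_(0 <= n <oo) `|Phi n f|); split.
  apply: ge0_emeasurable_sum => // n _.
  by apply: measurableT_comp => //; case: (PhiP n).
have [N [mN N0 sN]] := ae_foralln (fun n => (PhiP n).2).
exists N; split => //; first exact: Q'P.
apply: subset_trans sN => w; apply: contra_not => H.
have H' n : Phi n (fun s => Y (s, w)) = \int[mun n]_s Y (s, w) by exact: H.
rewrite /= (eq_measure_integral (mseries mun 0)); last first.
  by move=> A mA _; exact: sfinite_measure_seqP.
rewrite ge0_integral_measure_series//; last exact: measurable_fun_pair1.
apply: eq_eseriesr => n _; rewrite H' gee0_abs//; exact: integral_ge0.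
Qed.

End PathIntegral.

(** * The exponent measure *)

Section ExtendedReals.
Context {R : realType}.

Lemma measurable_expeR : measurable_fun [set: \bar R] (@expeR R).
Proof.
rewrite (_ : @expeR R = fun x => if x == -oo then 0 else if x == +oo then +oo
    else (expR (fine x))%:E); last by apply/funext; case.
apply: measurable_fun_ifT => //; first exact: measurable_fun_eqe.
apply: measurable_fun_ifT => //; first exact: measurable_fun_eqe.
by apply/measurable_EFinP; apply: measurableT_comp.
Qed.

Lemma measurable_lne : measurable_fun [set: \bar R] (@lne R).
Proof.
rewrite (_ : @lne R = fun x => if x <= 0 then -oo else if x == +oo then +oo
    else (ln (fine x))%:E); last first.
  by apply/funext => -[r||] //=; rewrite leNye.
apply: measurable_fun_ifT => //; first exact: measurable_fun_lee.
apply: measurable_fun_ifT => //; first exact: measurable_fun_eqe.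
by apply/measurable_EFinP; apply: measurableT_comp.
Qed.

(** The empty maximum is -oo, so no level is exceeded when n = 0; the convention
-oo - (-oo) = -oo makes a missing coordinate harmless at every level. *)
Definition max_excess n (y x : 'I_n -> \bar R) : \bar R :=
  \big[maxe/-oo]_(j < n) (y j - x j).

Lemma max_excess_le n (y x : 'I_n -> \bar R) c :
  max_excess y x <= c <-> forall j, y j - x j <= c.
Proof.
split=> [H j|H]; last by apply: bigmax_le => //; exact: leNye.
by apply: le_trans H; exact: le_bigmax.
Qed.

(** A shifted vector leaves a box exactly when the shift passes a threshold, which
reduces every computation to the intensity of a half-line. *)
Lemma translated_le n (y x : 'I_n -> \bar R) (p : R) :
  (~ (forall j, p%:E + y j <= x j)) <-> - max_excess y x < p%:E.
Proof.
have one (a b : \bar R) : (p%:E + a <= b) = (a - b <= - p%:E).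
  case: a b => [a||] [b||]; rewrite /= ?leNye ?leey ?leye_eq ?leeNy_eq//.
  by rewrite -EFinB !lee_fin; apply/idP/idP; lra.
rewrite ltNge leeNr; split.
  move=> H; apply/negP => /max_excess_le H'; apply: H => j.
  by rewrite one.
by move=> /negP H H'; apply: H; apply/max_excess_le => j; rewrite -one.
Qed.

Lemma measurable_max_excess d (S : measurableType d) n (Y : 'I_n -> S -> \bar R)
    (x : 'I_n -> \bar R) :
  (forall j, measurable_fun setT (Y j)) ->
  measurable_fun setT (fun w => max_excess (Y ^~ w) x).
Proof.
move=> mY; rewrite /max_excess.
elim: (index_enum _) => [|j s IH].
  by under eq_fun do rewrite big_nil; exact: measurable_cst.
under eq_fun do rewrite big_cons.
by apply: measurable_maxe => //; exact: emeasurable_funB.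
Qed.

End ExtendedReals.

Section ProductSections.
Context {R : realType} {d1 d2} {S1 : measurableType d1} {S2 : measurableType d2}.
Context (m1 : {sigma_finite_measure set S1 -> \bar R}).
Context (m2 : {sigma_finite_measure set S2 -> \bar R}).

Lemma product_xsection (A : set (S1 * S2)) :
  (m1 \x m2) A = \int[m1]_x m2 [set y | A (x, y)].
Proof.
rewrite /product_measure1; apply: eq_integral => x _ /=; congr (m2 _).
by apply/seteqP; split => y; rewrite /xsection/= inE.
Qed.

Lemma product_ysection (A : set (S1 * S2)) : measurable A ->
  (m1 \x m2) A = \int[m2]_y m1 [set x | A (x, y)].
Proof.
move=> mA; rewrite /product_measure1 -(indic_fubini_tonelli_FE m2 mA).
rewrite indic_fubini_tonelli// indic_fubini_tonelli_GE//.
apply: eq_integral => y _ /=; congr (m1 _).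
by apply/seteqP; split => x; rewrite /ysection/= inE.
Qed.
End ProductSections.

Section ExponentMeasure.
Context {R : realType} {d} {Omega : measurableType d} (P : probability Omega R).
Context (n : nat) (Y : 'I_n -> Omega -> \bar R).
Hypothesis mY : forall j, measurable_fun setT (Y j).

(** E exp(max_j (Y_j - x_j)), minus the logarithm of the distribution function of
the associated max-stable vector. *)
Definition exponent_measure_cdf (x : 'I_n -> \bar R) : \bar R :=
  \int[P]_w expeR (max_excess (Y ^~ w) x).

Local Notation nu := (@exp_intensity R).

Lemma measurable_exceed (x : 'I_n -> \bar R) :
  measurable [set z : R * Omega | ~ forall j, z.1%:E + Y j z.2 <= x j].
Proof.
rewrite (_ : [set _ | _] = [set z | - max_excess (Y ^~ z.2) x < z.1%:E]).
  rewrite -[X in measurable X]setTI; apply: measurable_lte => //.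
    apply: measurableT_comp => //.
    apply: (measurableT_comp (measurable_max_excess _ mY)) => //.
  by apply/measurable_EFinP.
by apply/seteqP; split => z /= /translated_le.
Qed.

Lemma exponent_measureE (x : 'I_n -> \bar R) :
  (nu \x P) [set z | ~ forall j, z.1%:E + Y j z.2 <= x j] = exponent_measure_cdf x.
Proof.
rewrite product_ysection; last exact: measurable_exceed.
apply: eq_integral => w _ /=.
rewrite -[RHS](_ : expeR (- - max_excess (Y ^~ w) x) = _); last by rewrite oppeK.
rewrite -exp_intensity_eray; congr exp_intensity.
by apply/seteqP; split => p /= /translated_le.
Qed.

End ExponentMeasure.

(** * Distribution functions of max-stable processes *)

Lemma measurable_mktuple (R : realType) d (S : measurableType d) n
    (Y : 'I_n -> S -> \bar R) : (forall j, measurable_fun setT (Y j)) ->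
  measurable_fun setT (fun w => [tuple Y j w | j < n]).
Proof.
move=> mY; apply/measurable_fun_tnthP => j.
by rewrite (_ : _ \o _ = Y j)//; apply/funext => w /=; rewrite tnth_mktuple.
Qed.

Lemma measurable_preimageT d1 d2 (S1 : measurableType d1) (S2 : measurableType d2)
    (f : S1 -> S2) (A : set S2) :
  measurable_fun setT f -> measurable A -> measurable (f @^-1` A).
Proof. by move=> mf mA; rewrite -[X in measurable X]setTI; exact: mf. Qed.

Section MaxStableCdf.
Context {R : realType} {T : Type} {d} {Omega : measurableType d} (P : probability Omega R).
Context (Z : T -> Omega -> \bar R).
Hypothesis mZ : forall t, measurable_fun setT (Z t).
Context {d1} {Omega1 : measurableType d1} (P1 : probability Omega1 R).
Context (zeta : T -> Omega1 -> \bar R).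
Hypothesis zetaZ : associated_max_stable P Z P1 zeta.

Lemma measurable_max_stable t : measurable_fun setT (zeta t).
Proof.
case: zetaZ => X [Zc [ppX Zcp _ zE]].
rewrite (_ : zeta t = fun w => esups (fun i => (X i w)%:E + Zc i t w) 0%N).
  apply: measurable_fun_esups => i; apply: emeasurable_funD.
    by apply/measurable_EFinP; case: ppX.
  by case: (Zcp i) => -[].
apply/funext => w; rewrite zE /esups/=; congr ereal_sup.
by apply/seteqP; split => _ [i _ <-]; exists i.
Qed.

(** The maximum is below x when every point, shifted by its mark, is; the mark is the
copy of Z restricted to the finitely many t_j, and its law has density 1 because
it does not depend on the point. *)
Theorem max_stable_cdf n (t : 'I_n -> T) (x : 'I_n -> \bar R) :
  P1 [set w | forall j, zeta (t j) w <= x j] =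
  expeR (- exponent_measure_cdf P (fun j => Z (t j)) x).
Proof.
case: zetaZ => X [Zc [ppX Zcp indep zE]].
pose V i w := [tuple Zc i (t j) w | j < n].
pose v (z : R * Omega) := [tuple Z (t j) z.2 | j < n].
pose u (z : R * Omega) : \bar R := 1.
pose G : set (R * n.-tuple (\bar R)) := [set z | forall j, z.1%:E + tnth z.2 j <= x j].
have mZc i s : measurable_fun setT (Zc i s) by case: (Zcp i) => -[].
have mX i : measurable_fun setT (X i) by case: ppX.
have mV i : measurable_fun setT (V i) by exact: measurable_mktuple.
have mv : measurable_fun setT v.
  by apply: measurable_mktuple => j; exact: measurableT_comp.
have mG : measurable G.
  rewrite -[G]setCK; apply: measurableC.
  exact: (@measurable_exceed _ _ (n.-tuple (\bar R)) _
    (fun j y => tnth y j) (fun j => @measurable_tnth _ _ n j) x).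
have mu1 : measurable_fun setT u by exact: measurable_cst.
have u0 z : 0 <= u z by [].
have ufin z : u z \is a fin_num by [].
have u1 p : \int[P]_w u (p, w) = 1 by rewrite integral_cst//= probability_setT mule1.
have KE D p : measurable D ->
    mark_prob P u v D p = P [set w | D (p, [tuple Z (t j) w | j < n])].
  move=> mD; rewrite /mark_prob/u/v /=.
  under eq_integral do rewrite mul1e.
  rewrite (_ : (fun w => _) = (fun w =>
    (\1_[set w | D (p, [tuple Z (t j) w | j < n])] w)%:E)); last first.
    by apply/funext => w; rewrite !indicE; congr ((nat_of_bool _)%:R%:E); rewrite !inE.
  rewrite integral_indic ?setIT//.
  apply: (@measurable_preimageT _ _ _ _ (fun w => (p, [tuple Z (t j) w | j < n]))) => //.
  by apply: measurable_fun_pair => //; exact: measurable_mktuple.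
have ZcZ C i : measurable C -> P1 [set w | C (V i w)] = P [set w | C [tuple Z (t j) w | j < n]].
  by move=> mC; case: (Zcp i) => _ H; exact: (H n t C mC).
have marksX m (A : set Omega1) (C : nat -> set (n.-tuple (\bar R))) :
    sigma_gen setT X A -> (forall i, measurable (C i)) ->
    P1 (A `&` \bigcap_(i in `I_m) [set w | C i (V i w)]) =
    \int[P1]_(w in A) \prod_(i < m) mark_prob P u v (setT `*` C i) (X i w).
  move=> sA mC.
  have mA : measurable A.
    apply: smallest_sub sA; first exact: sigma_algebra_measurable.
    by move=> B [i _ [D mD <-]]; exact: mX.
  (* None stands for the points and Some i for the i-th copy, as in the definition
     of the associated process. *)
  pose F (i : option nat) := if i is Some j then sigma_gen setT (Zc j) else sigma_gen setT X.
  pose A' (i : option nat) := if i is Some j then [set w | C j (V j w)] else A.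
  have FA' i : F i (A' i).
    case: i => [j|]//=.
    apply: (@measurable_preimageT _ _ (g_sigma_algebraType
      (\bigcup_s preimage_set_system setT (Zc j s) measurable)) _ (V j) (C j)) => //.
    apply: measurable_mktuple => l _ B mB; apply: sub_sigma_algebra.
    by exists (t l) => //; exists B.
  pose s : seq (option nat) := None :: map Some (iota 0 m).
  have us : uniq s.
    rewrite /s/= map_inj_uniq ?iota_uniq ?andbT; last by move=> a b [].
    by apply/mapP => -[].
  have sN : None \in s by rewrite mem_head.
  have sS i : (Some i \in s) = (i < m)%N.
    by rewrite /s in_cons/= mem_map ?mem_iota//; move=> a b [].
  have := indep s A' us FA'.
  rewrite (_ : \bigcap_(i in [set` s]) A' i = A `&` \bigcap_(i in `I_m) [set w | C i (V i w)]).
    move=> ->; rewrite /s big_cons big_map /=.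
    transitivity (\int[P1]_(w in A)
        cst (\prod_(i < m) P [set w | C i [tuple Z (t j) w | j < n]]) w); last first.
      apply: eq_integral => w _; apply: eq_bigr => i _.
      rewrite KE; last exact: measurableX.
      by congr (P _); apply/seteqP; split => y /=; [move=> Cy; split|case].
    rewrite integral_cst//.
    rewrite muleC; congr (_ * _).
    rewrite -(subn0 m) -/(index_iota 0 m) big_mkord subn0.
    by apply: eq_bigr => i _; rewrite ZcZ.
  apply/seteqP; split => w /=.
    move=> H; split; first exact: (H None sN).
    by move=> i im; apply: (H (Some i)); rewrite /= sS.
  by move=> [Aw H] [i|] /=; [rewrite sS => /H|].
have := marked_poisson_void mX mV mu1 mv u0 ufin u1 marksX ppX mG.
rewrite (_ : [set w | forall i, G (X i w, V i w)] = [set w | forall j, zeta (t j) w <= x j]).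
  move=> ->; congr (expeR (- _)).
  rewrite -exponent_measureE// product_xsection; apply: eq_integral => p _.
  rewrite KE; last exact: measurableC.
  congr (P _); apply/seteqP; split => w /=; apply: contra_not => H j.
    by rewrite /= tnth_mktuple; exact: H.
  by have := H j; rewrite /= tnth_mktuple.
apply/seteqP; split => w /=.
  move=> H j; rewrite zE; apply: ge_ereal_sup => _ [i _ <-].
  by have := H i j; rewrite /= tnth_mktuple.
move=> H i j /=; rewrite tnth_mktuple; apply: le_trans (H j); rewrite zE.
by apply: ereal_sup_ubound; exists i.
Qed.
End MaxStableCdf.

(** * Generalised Pareto distributions *)

(** The measure structure of a pushforward depends on a proof of measurability of the
map, which is supplied explicitly. *)
Definition image_measure (R : realType) d1 d2 (S1 : measurableType d1)
    (S2 : measurableType d2) (m : {measure set S1 -> \bar R}) (f : S1 -> S2)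
    (mf : measurable_fun setT f) : {measure set S2 -> \bar R} :=
  measure_function_pushforward__canonical__measure_function_Measure m mf.

Section ExponentBounds.
Context {R : realType} {d} {Omega : measurableType d} (P : probability Omega R).
Context (n : nat) (Y : 'I_n -> Omega -> \bar R).
Hypothesis mY : forall j, measurable_fun setT (Y j).
Hypothesis Y1 : forall j, \int[P]_w expeR (Y j w) = 1.

Lemma expeR_max_excess_le (y x : 'I_n -> \bar R) :
  expeR (max_excess y x) <= \sum_(j < n) expeR (y j - x j).
Proof.
rewrite /max_excess; elim/big_rec2: _ => //= j a b _ ab.
rewrite /Order.max; case: ifPn => _.
  by apply: le_trans ab _; rewrite leeDr// expeR_ge0.
by rewrite leeDl//; apply: le_trans ab; exact: expeR_ge0.
Qed.

Lemma expeRB (a : \bar R) (r : R) : expeR (a - r%:E) = (expR (- r))%:E * expeR a.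
Proof. by rewrite expeRD muleC. Qed.

Lemma exponent_measure_le (x : 'I_n -> R) :
  exponent_measure_cdf P Y (EFin \o x) <= (\sum_(j < n) expR (- x j))%:E.
Proof.
have mexp j : measurable_fun setT (fun w => expeR (Y j w)).
  exact: (measurableT_comp measurable_expeR).
apply: (@le_trans _ _ (\int[P]_w \sum_(j < n) ((expR (- x j))%:E * expeR (Y j w)))).
  apply: ge0_le_integral => //.
  - by move=> w _; exact: expeR_ge0.
  - by apply: (measurableT_comp measurable_expeR); exact: measurable_max_excess.
  - by apply: emeasurable_sum => j; exact: emeasurable_funM.
  - move=> w _; apply: le_trans (expeR_max_excess_le _ _) _.
    by apply: lee_sum => j _; rewrite expeRB.
rewrite ge0_integral_sum//; last 2 first.
- by move=> j; exact: emeasurable_funM.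
- by move=> j w _; rewrite mule_ge0 ?lee_fin ?expR_ge0 ?expeR_ge0.
rewrite -sumEFin; apply: lee_sum => j _.
by rewrite ge0_integralZl ?lee_fin ?expR_ge0 ?Y1 ?mule1// => w _; exact: expeR_ge0.
Qed.

Lemma exponent_measure_fin (x : 'I_n -> R) :
  exponent_measure_cdf P Y (EFin \o x) \is a fin_num.
Proof.
rewrite ge0_fin_numE; first exact: le_lt_trans (exponent_measure_le x) (ltry _).
by apply: integral_ge0 => w _; exact: expeR_ge0.
Qed.

Lemma exponent_measure_ge1 (j : 'I_n) : 1 <= exponent_measure_cdf P Y (fun=> 0).
Proof.
rewrite -(Y1 j); apply: ge0_le_integral => //.
- by move=> w _; exact: expeR_ge0.
- exact: (measurableT_comp measurable_expeR).
- by apply: (measurableT_comp measurable_expeR); exact: measurable_max_excess.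
- move=> w _; rewrite lee_expeR.
  have /max_excess_le := lexx (max_excess (Y ^~ w) (fun=> 0)).
  by move=> /(_ j); rewrite sube0.
Qed.

End ExponentBounds.

Section GeneralisedPareto.
Context {R : realType} {d} {Omega : measurableType d} (P : probability Omega R).
Context (n : nat) (Y : 'I_n -> Omega -> \bar R).
Hypothesis mY : forall j, measurable_fun setT (Y j).
Hypothesis Yy : forall j w, Y j w < +oo.
Hypothesis Y1 : forall j, \int[P]_w expeR (Y j w) = 1.

Local Notation nu := (@exp_intensity R).
Local Notation ell x := (exponent_measure_cdf P Y (EFin \o x)).

Let exceed (x : 'I_n -> \bar R) : set (R * Omega) :=
  [set z | ~ forall j, z.1%:E + Y j z.2 <= x j].

Let shifted (z : R * Omega) := [tuple z.1%:E + Y j z.2 | j < n].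

Let mexceed x : measurable (exceed x). Proof. exact: measurable_exceed. Qed.

Let mshifted : measurable_fun setT shifted.
Proof.
apply: measurable_mktuple => j; apply: emeasurable_funD.
  by apply/measurable_EFinP.
exact: measurableT_comp.
Qed.

(** With H = exp(- ell), G(x) = (ell(min(x,0)) - ell(x)) / ell(0), and ell(x) is the
mass of the event that the shifted vector is not below x. The difference is the
mass of those shifted vectors below x that are not below 0. *)
Theorem gpd_law (i0 : 'I_n) d3 (Omega3 : measurableType d3) (P3 : probability Omega3 R)
    (W : 'I_n -> Omega3 -> \bar R) (H : ('I_n -> R) -> R) :
  is_process W -> (forall x, H x = expR (- fine (ell x))) ->
  (forall x, joint_cdf P3 W x = gpd_cdf H x) ->
  forall B, measurable B -> P3 [set w | B [tuple W j w | j < n]] =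
    (fine (ell (fun=> 0%R)))^-1%:E *
    (nu \x P) (shifted @^-1` B `&` exceed (fun=> 0)).
Proof.
move=> [mW Wy] HE WG B mB.
pose l0 := fine (ell (fun=> 0%R)).
have l0E : ell (fun=> 0%R) = l0%:E by rewrite fineK// exponent_measure_fin.
have l0gt0 : (0 < l0)%R.
  by apply: lt_le_trans ltr01 _; rewrite -lee_fin -l0E; exact: (exponent_measure_ge1 mY Y1 i0).
have l0V : (0 <= l0^-1)%R by rewrite invr_ge0 ltW.
have mWt : measurable_fun setT (fun w => [tuple W j w | j < n]) by exact: measurable_mktuple.
pose m1 := image_measure P3 mWt.
pose m2 : {measure set (n.-tuple (\bar R)) -> \bar R} :=
  mscale (NngNum l0V) (image_measure (mrestr (nu \x P) (mexceed (fun=> 0))) mshifted).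
have m1E C : m1 C = P3 [set w | C [tuple W j w | j < n]] by [].
have m2E C : m2 C = l0^-1%:E * (nu \x P) (shifted @^-1` C `&` exceed (fun=> 0)) by [].
rewrite -m1E -m2E; apply: eq_measure_fin_box => //.
- by rewrite m1E probability_setT ltry.
- rewrite m1E probability_setT m2E preimage_setT setTI.
  by rewrite exponent_measureE// l0E -EFinM mulVf// gt_eqF.
- rewrite m1E (_ : [set w | _] = set0) ?measure0//.
  apply/seteqP; split => // w /= [j]; rewrite tnth_mktuple => e.
  by have := Wy j w; rewrite e ltxx.
- rewrite m2E (_ : _ `&` _ = set0) ?measure0 ?mule0//.
  apply/seteqP; split => // z [/= [j]]; rewrite tnth_mktuple => e _.
  have := Yy j z.2; have : z.1%:E + Y j z.2 != -oo by rewrite e.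
  by case: (Y j z.2) e.
move=> x.
pose x0 j := Num.min (x j) 0%R.
have sub : exceed (EFin \o x) `<=` exceed (EFin \o x0).
  move=> z /=; apply: contra_not => xz j; apply: le_trans (xz j) _.
  by rewrite lee_fin /x0 ge_min lexx.
have e2 : shifted @^-1` (box (EFin \o x)) `&` exceed (fun=> 0) =
    exceed (EFin \o x0) `\` exceed (EFin \o x).
  apply/seteqP; split => z.
    move=> [bz ez]; split; last first.
      move=> H'; apply: H' => j.
      by have := bz j; rewrite tnth_mktuple.
    move: ez; apply: contra_not => H' j; apply: le_trans (H' j) _.
    by rewrite lee_fin /x0 ge_min lexx orbT.
  move=> [ez /contrapT bz]; split.
    by move=> j; rewrite tnth_mktuple; exact: bz.
  move: ez; apply: contra_not => H' j; rewrite /= /x0 EFin_min le_min.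
  by rewrite (bz j) H'.
rewrite m1E m2E e2.
have fin y : (nu \x P) (exceed (EFin \o y)) < +oo.
  by rewrite exponent_measureE// -ge0_fin_numE ?exponent_measure_fin//; apply: integral_ge0 => w _; exact: expeR_ge0.
have -> : (nu \x P) (exceed (EFin \o x0) `\` exceed (EFin \o x)) =
    (nu \x P) (exceed (EFin \o x0)) -
    (nu \x P) (exceed (EFin \o x0) `&` exceed (EFin \o x)).
  have := @measureD _ _ _ (nu \x P) _ _ (mexceed (EFin \o x0)) (mexceed (EFin \o x)).
  by move=> /(_ (fin x0)); exact.
rewrite (setIidr sub) !exponent_measureE//.
have <- : (joint_cdf P3 W x)%:E = P3 [set w | box (EFin \o x) [tuple W j w | j < n]].
  rewrite /joint_cdf (_ : [set w | _] =
      (fun w => [tuple W j w | j < n]) @^-1` box (EFin \o x)); last first.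
    by apply/seteqP; split => w /= Hw j; have := Hw j; rewrite tnth_mktuple.
  rewrite fineK// fin_num_measure//; apply: measurable_preimageT => //.
  exact: measurable_box.
rewrite WG /gpd_cdf !HE -/l0 expRK.
rewrite -(fineK (exponent_measure_fin mY Y1 x0)) -(fineK (exponent_measure_fin mY Y1 x)).
rewrite -EFinB -EFinM; congr _%:E.
rewrite -expRN opprK -expRD expRK -/x0.
by field; rewrite gt_eqF.
Qed.

End GeneralisedPareto.

(** * Tilting and the increments of generalised Pareto vectors *)

Section ConditionalGpd.
Context {R : realType} {d} {Omega : measurableType d} (P : probability Omega R).
Context (n : nat) (Y : 'I_n.+1 -> Omega -> \bar R).
Hypothesis mY : forall j, measurable_fun setT (Y j).
Hypothesis Yy : forall j w, Y j w < +oo.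
Hypothesis Y1 : forall j, \int[P]_w expeR (Y j w) = 1.

Local Notation nu := (@exp_intensity R).
Local Notation ell x := (exponent_measure_cdf P Y (EFin \o x)).

Definition increments (S : Type) (V : 'I_n.+1 -> S -> \bar R) (w : S) :
  n.-tuple (\bar R) := [tuple V (lift ord0 j) w - V ord0 w | j < n].

Lemma measurable_increments d' (S : measurableType d') (V : 'I_n.+1 -> S -> \bar R) :
  (forall j, measurable_fun setT (V j)) -> measurable_fun setT (increments V).
Proof.
by move=> mV; apply: measurable_mktuple => j; exact: emeasurable_funB.
Qed.

(** A shift by p does not change the increments, and the shifted first component is
positive when p > - Y_0, an event of nu-mass e^(Y_0). *)
Lemma increments_gpd d3 (Omega3 : measurableType d3) (P3 : probability Omega3 R)
    (W : 'I_n.+1 -> Omega3 -> \bar R) (H : ('I_n.+1 -> R) -> R) :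
  is_process W -> (forall x, H x = expR (- fine (ell x))) ->
  (forall x, joint_cdf P3 W x = gpd_cdf H x) ->
  forall B, measurable B ->
    P3 ([set w | B (increments W w)] `&` [set w | 0 < W ord0 w]) =
    (fine (ell (fun=> 0%R)))^-1%:E *
    \int[P]_w (expeR (Y ord0 w) * (\1_B (increments Y w))%:E).
Proof.
move=> pW HE WG B mB.
pose B' : set (n.+1.-tuple (\bar R)) :=
  [set y | B (increments (fun j y => tnth y j) y) /\ 0 < tnth y ord0].
have mt j : measurable_fun setT (fun y : n.+1.-tuple (\bar R) => tnth y j).
  exact: measurable_tnth.
have mB' : measurable B'.
  apply: measurableI.
    exact: (measurable_preimageT (measurable_increments mt)).
  rewrite -[X in measurable X]setTI; exact: emeasurable_fun_o_infty.
rewrite (_ : _ `&` _ = [set w | B' [tuple W j w | j < n.+1]]); last first.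
  apply/seteqP; split => w; rewrite /B' /increments /=.
    move=> [Bw W0]; rewrite tnth_mktuple; split => //.
    by under eq_mktuple do rewrite !tnth_mktuple.
  move=> []; rewrite tnth_mktuple => Bw W0; split => //; move: Bw.
  by under eq_mktuple do rewrite !tnth_mktuple.
rewrite (gpd_law mY Yy Y1 ord0 pW HE WG mB'); congr (_ * _).
rewrite product_ysection; last first.
  apply: measurableI; last exact: measurable_exceed.
  apply: measurable_preimageT mB'; apply: measurable_mktuple => j.
  by apply: emeasurable_funD; [apply/measurable_EFinP|exact: measurableT_comp].
apply: eq_integral => w _.
have shiftE (p r : R) (y : \bar R) : (p%:E + y) - (p%:E + r%:E) = y - r%:E.
  case: y => [y||]//=.
  by congr _%:E; ring.
(* If Y_0 = -oo the first component is not positive and the weight vanishes. *)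
have [Y0|Y0] := eqVneq (Y ord0 w) -oo.
  rewrite Y0 /= mul0e (_ : [set x | _] = set0) ?measure0//.
  by apply/seteqP; split => // p /= [[_]]; rewrite tnth_mktuple Y0.
have [r rE] : exists r, Y ord0 w = r%:E.
  by move: Y0 (Yy ord0 w); case: (Y ord0 w) => [r _ _| |]//; exists r.
have -> : [set p : R | ((fun z : R * Omega => [tuple z.1%:E + Y j z.2 | j < n.+1]) @^-1` B'
     `&` [set z | ~ forall j, z.1%:E + Y j z.2 <= 0]) (p, w)] =
    [set p | B (increments Y w) /\ - Y ord0 w < p%:E].
  have incE p : increments (fun j y => tnth y j) [tuple p%:E + Y j w | j < n.+1] =
      increments Y w.
    by apply: eq_mktuple => j; rewrite !tnth_mktuple rE shiftE.
  have posE p : (0 < p%:E + Y ord0 w) = (- Y ord0 w < p%:E).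
    by rewrite rE -EFinD -EFinN !lte_fin -[in RHS]subr_gt0 opprK.
  apply/seteqP; split => p /=; rewrite /B' /= incE tnth_mktuple posE.
    by case=> -[].
  move=> [Bw p0]; split => // /(_ ord0) le0.
  by move: p0; rewrite -posE ltNge le0.
rewrite indicE; have [Bw|Bw] := boolP (increments Y w \in B).
  rewrite mule1 -[RHS](_ : expeR (- - Y ord0 w) = _); last by rewrite oppeK.
  rewrite -exp_intensity_eray; congr exp_intensity.
  by apply/seteqP; split => p /=; [case|move=> ?; split => //; exact: set_mem].
rewrite mule0 (_ : [set p | _] = set0) ?measure0//.
by apply/seteqP; split => // p /= [Bw']; move: Bw; rewrite notin_setE.
Qed.
End ConditionalGpd.

Section TiltLaw.
Context {R : realType} {T : Type} {d} {Omega : measurableType d} (P : probability Omega R).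
Context (Z : T -> Omega -> \bar R).
Hypothesis Zp : is_process Z.

Lemma path_events_paths_borel (A : set (T -> \bar R)) :
  @path_events R T A -> @paths_borel R T (@paths R T `&` A).
Proof.
move: A; apply: smallest_sub.
  apply: (@sigma_algebra_image _ _ (@paths R T) id).
  exact: smallest_sigma_algebra.
move=> _ [t _ [C mC <-]]; rewrite /image_set_system/= setTI.
by apply: sub_sigma_algebra; exists t => //; exists C.
Qed.

(** The weight e^(Z(h)) vanishes on the constant path -oo, so tilted laws do not see
the restriction to paths that are finite somewhere. *)
Lemma weighted_paths (h : T) (A : set (T -> \bar R)) w :
  expeR (Z h w) * (\1_(@paths R T `&` A) (Z ^~ w))%:E =
  expeR (Z h w) * (\1_A (Z ^~ w))%:E.
Proof.
have [->|Zh] := eqVneq (Z h w) -oo; first by rewrite /= !mul0e.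
congr (_ * (nat_of_bool _)%:R%:E); apply/idP/idP; rewrite !inE; first by case.
move=> Aw; split => //; split; first by move=> t; case: Zp.
by exists h; rewrite ltNye.
Qed.

Lemma tilt_law_path_event (h : T) (A : set (T -> \bar R)) :
  tilt_law P Z h (@paths R T `&` A) = \int[P]_w (expeR (Z h w) * (\1_A (Z ^~ w))%:E).
Proof. by apply: eq_integral => w _; exact: weighted_paths. Qed.

Lemma spectral_lawE (h : T) (B : set (T -> \bar R)) :
  spectral_law P Z h B =
  \int[P]_w (expeR (Z h w) * (\1_B (fun t => (Z t w - Z h w)%E))%:E).
Proof.
rewrite /spectral_law (_ : [set f | _] =
  @paths R T `&` [set f | B (fun t => f t - f h)])//.
rewrite tilt_law_path_event; apply: eq_integral => w _.
by rewrite !indicE; congr (_ * (nat_of_bool _)%:R%:E); rewrite !inE.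
Qed.
End TiltLaw.

Section TiltedIncrements.
Context {R : realType} {T : Type} {d} {Omega : measurableType d} (P : probability Omega R).
Context (Z : T -> Omega -> \bar R).
Hypothesis Zp : is_process Z.
Hypothesis Z1 : forall t, \int[P]_w expeR (Z t w) = 1.
Context {d1} {Omega1 : measurableType d1} (P1 : probability Omega1 R).
Context (zeta : T -> Omega1 -> \bar R).
Hypothesis zetaZ : associated_max_stable P Z P1 zeta.

(** Both sides are E[e^(Z(h)); increments in B]: on the left by the definition of the
tilt, on the right up to the factor 1 / ell(0), which is P(W_1 > 0). *)
Theorem tilted_increments_law n (t : 'I_n.+1 -> T)
    d2 (Omega2 : measurableType d2) (P2 : probability Omega2 R) (Zh : T -> Omega2 -> \bar R)
    d3 (Omega3 : measurableType d3) (P3 : probability Omega3 R)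
    (W : 'I_n.+1 -> Omega3 -> \bar R)
    d4 (Omega4 : measurableType d4) (P4 : probability Omega4 R)
    (Wh : 'I_n.+1 -> Omega4 -> \bar R) :
  is_tilt P Z (t ord0) P2 Zh -> is_process W ->
  (forall x, joint_cdf P3 W x = gpd_cdf (joint_cdf P1 (fun j => zeta (t j))) x) ->
  has_conditional_law P3 W [set w | 0 < W ord0 w] P4 Wh ->
  eq_law P2 (fun (j : 'I_n) w => Zh (t (lift ord0 j)) w - Zh (t ord0) w)
    P4 (fun (j : 'I_n) w => Wh (lift ord0 j) w - Wh ord0 w).
Proof.
move=> [_ Zhp Zhlaw] pW WG Whlaw B mB.
have [mZ Zy] := Zp.
pose Y j := Z (t j).
have mY j : measurable_fun setT (Y j) by exact: mZ.
have Yy j w : Y j w < +oo by exact: Zy.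
have Y1 j : \int[P]_w expeR (Y j w) = 1 by exact: Z1.
have HE x : joint_cdf P1 (fun j => zeta (t j)) x =
    expR (- fine (exponent_measure_cdf P Y (EFin \o x))).
  rewrite /joint_cdf (max_stable_cdf mZ zetaZ t (EFin \o x)).
  by rewrite -(fineK (exponent_measure_fin mY Y1 x)).
set I := \int[P]_w (expeR (Y ord0 w) * (\1_B (increments Y w))%:E).
have lhs : P2 [set w | B [tuple Zh (t (lift ord0 j)) w - Zh (t ord0) w | j < n]] = I.
  pose A : set (T -> \bar R) := [set f | B (increments (fun j (f : T -> \bar R) => f (t j)) f)].
  have mA : @path_events R T A.
    apply: (@measurable_preimageT _ _ (path_space R T) _ _ B) mB.
    apply: measurable_increments => j; exact: measurable_eval.
  have := Zhlaw _ (path_events_paths_borel mA).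
  rewrite (tilt_law_path_event P Zp) => e.
  transitivity (P2 [set w | (@paths R T `&` A) (Zh ^~ w)]).
    congr (P2 _); apply/seteqP; split => w /=; last by case.
    by move=> Bw; split; [exact: Zhp|].
  by rewrite e; apply: eq_integral.
rewrite lhs.
have mW j : measurable_fun setT (W j) by case: pW.
pose B' : set (n.+1.-tuple (\bar R)) :=
  [set y | B (increments (fun j y => tnth y j) y)].
have mB' : measurable B'.
  apply: (measurable_preimageT (measurable_increments _) mB) => j.
  exact: measurable_tnth.
have BE S (V : 'I_n.+1 -> S -> \bar R) w : B' [tuple V j w | j < n.+1] = B (increments V w).
  by rewrite /B'/=; congr B; apply: eq_mktuple => j; rewrite !tnth_mktuple.
have := Whlaw B' mB'.
have -> : [set w | B' [tuple Wh j w | j < n.+1]] =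
    [set w | B [tuple Wh (lift ord0 j) w - Wh ord0 w | j < n]].
  by apply/funext => w; rewrite /= BE.
move=> ->.
have -> : [set w | B' [tuple W j w | j < n.+1]] = [set w | B (increments W w)].
  by apply/funext => w; rewrite /= BE.
rewrite (increments_gpd mY Yy Y1 pW HE WG mB) -/I.
pose l0 := fine (exponent_measure_cdf P Y (EFin \o (fun=> 0%R))).
rewrite -/l0.
have l0gt0 : (0 < l0)%R.
  apply: lt_le_trans ltr01 _; rewrite -lee_fin fineK; last exact: exponent_measure_fin.
  exact: (exponent_measure_ge1 mY Y1 ord0).
have -> : P3 [set w | 0 < W ord0 w] = (l0^-1)%:E.
  have := increments_gpd mY Yy Y1 pW HE WG measurableT.
  rewrite setTI => ->; rewrite -/l0 -[RHS]mule1 -(Y1 ord0); congr (_ * _).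
  by apply: eq_integral => w _; rewrite indicT mule1.
rewrite inver gt_eqF ?invr_gt0//= muleAC -EFinM divff ?mul1e// gt_eqF//.
by rewrite invr_gt0.
Qed.
End TiltedIncrements.

(** * Null sets in product spaces *)

Section SigmaFiniteProduct.
Context {R : realType} {d1 d2} {S1 : measurableType d1} {S2 : measurableType d2}.
Context (m1 : {sigma_finite_measure set S1 -> \bar R}).
Context (m2 : {sigma_finite_measure set S2 -> \bar R}).

(** A separate name lets the product carry its sigma-finiteness, so that products
can be iterated. *)
Definition sigma_finite_product := m1 \x m2.

HB.instance Definition _ := Measure.on sigma_finite_product.

Let sigma_finite_product_sigma_finite : sigma_finite setT sigma_finite_product.
Proof.
have /sigma_finiteP[F [TF ndF Foo]] := sigma_finiteT m1.
have /sigma_finiteP[G [TG ndG Goo]] := sigma_finiteT m2.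
exists (fun n => F n `*` G n) => [|n].
  apply/seteqP; split => // -[x y] _.
  have [k _ Fx] : (\bigcup_k F k) x by rewrite -TF.
  have [l _ Gy] : (\bigcup_k G k) y by rewrite -TG.
  exists (maxn k l) => //; split => /=.
    by move: x Fx; exact/subsetPset/ndF/leq_maxl.
  by move: y Gy; exact/subsetPset/ndG/leq_maxr.
have [mF Fn] := Foo n; have [mG Gn] := Goo n.
split; first exact: measurableX.
by rewrite [ltLHS]product_measure1E// lte_mul_pinfty// ge0_fin_numE.
Qed.

HB.instance Definition _ := Measure_isSigmaFinite.Build _ _ _ sigma_finite_product
  sigma_finite_product_sigma_finite.

End SigmaFiniteProduct.

Section NullSections.
Context {R : realType} {d1 d2} {S1 : measurableType d1} {S2 : measurableType d2}.
Context (m1 : {sigma_finite_measure set S1 -> \bar R}).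
Context (m2 : {sigma_finite_measure set S2 -> \bar R}).
Context (N : set (S1 * S2)).
Hypothesis mN : measurable N.
Hypothesis N0 : (m1 \x m2) N = 0.

Lemma ae_xsection_null : {ae m1, forall x, m2 [set y | N (x, y)] = 0}.
Proof.
have mf : measurable_fun setT (fun x => m2 [set y | N (x, y)]).
  rewrite (_ : (fun x => _) = m2 \o xsection N); first exact: measurable_fun_xsection.
  apply/funext => x /=; congr (m2 _).
  by apply/seteqP; split => y; rewrite /xsection/= inE.
have : \int[m1]_x `|m2 [set y | N (x, y)]| = 0.
  rewrite -[RHS]N0 product_xsection; apply: eq_integral => x _; exact: gee0_abs.
by move=> /(ae_eq_integral_abs m1 measurableT mf); apply: filterS => x; exact.
Qed.

Lemma ae_ysection_null : {ae m2, forall y, m1 [set x | N (x, y)] = 0}.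
Proof.
have mf : measurable_fun setT (fun y => m1 [set x | N (x, y)]).
  rewrite (_ : (fun y => _) = m1 \o ysection N); first exact: measurable_fun_ysection.
  apply/funext => y /=; congr (m1 _).
  by apply/seteqP; split => x; rewrite /ysection/= inE.
have : \int[m2]_y `|m1 [set x | N (x, y)]| = 0.
  rewrite -[RHS]N0 product_ysection//; apply: eq_integral => y _; exact: gee0_abs.
by move=> /(ae_eq_integral_abs m2 measurableT mf); apply: filterS => y; exact.
Qed.

End NullSections.

Section ProductAlmostEverywhere.
Context {R : realType} {d1 d2} {S1 : measurableType d1} {S2 : measurableType d2}.
Context (m1 : {sigma_finite_measure set S1 -> \bar R}).
Context (m2 : {sigma_finite_measure set S2 -> \bar R}).

Lemma ae_prod_fst (A : S1 -> Prop) : m2 setT != 0 ->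
  {ae m1 \x m2, forall z, A z.1} -> {ae m1, forall x, A x}.
Proof.
move=> m2T [N [mN N0 sN]].
apply: filterS (ae_xsection_null mN N0) => x Nx; apply: contrapT => nA.
move/eqP : m2T; apply; rewrite -[RHS]Nx; congr (m2 _).
by apply/seteqP; split => // y _; exact: sN.
Qed.

Lemma ae_prod_snd (A : S2 -> Prop) : m1 setT != 0 ->
  {ae m1 \x m2, forall z, A z.2} -> {ae m2, forall y, A y}.
Proof.
move=> m1T [N [mN N0 sN]].
apply: filterS (ae_ysection_null mN N0) => y Ny; apply: contrapT => nA.
move/eqP : m1T; apply; rewrite -[RHS]Ny; congr (m1 _).
by apply/seteqP; split => // x _; exact: sN.
Qed.

End ProductAlmostEverywhere.

(** Sigma-finiteness at the measurable structure of nat that product spaces use. *)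
HB.instance Definition _ (R : realType) :=
  Measure_isSigmaFinite.Build _ _ _ (@counting nat R) (sigma_finite_counting R).

(** With the counting measure as first factor, a single null set in the product
controls countably many statements at once. *)
Lemma ae_counting_slices (R : realType) d (S : measurableType d)
    (m : {sigma_finite_measure set S -> \bar R}) (A : nat * S -> Prop) :
  {ae (@counting nat R) \x m, forall z, A z} -> forall i, {ae m, forall y, A (i, y)}.
Proof.
move=> [N [mN N0 sN]] i.
exists [set y | N (i, y)]; split; last by move=> y /= nA; exact: (sN (i, y)).
- rewrite (_ : [set y | _] = xsection N i); first exact: measurable_xsection.
  by apply/seteqP; split => y; rewrite /xsection/= inE.
- have := @product_xsection R _ _ nat S (@counting nat R) m N.
  rewrite [LHS]N0 ge0_integral_count// => /esym sum0.
  apply/eqP; rewrite -measure_le0 -sum0.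
  have := @nneseries_lim_ge R (fun k => m [set y | N (k, y)]) xpredT 0 i.+1.
  rewrite big_nat_recr//= => H; apply: le_trans (H _) => //.
  by rewrite leeDr// sume_ge0.
Qed.

Lemma measurable_nat_slices d1 d2 d3 (S1 : measurableType d1)
    (S2 : measurableType d2) (U : measurableType d3) (F : S1 * (nat * S2) -> U) :
  (forall i, measurable_fun setT (fun z : S1 * S2 => F (z.1, (i, z.2)))) ->
  measurable_fun setT F.
Proof.
move=> mF _ B mB; rewrite setTI.
rewrite (_ : F @^-1` B = \bigcup_i ([set z | z.2.1 = i] `&`
   (fun z : S1 * (nat * S2) => (z.1, z.2.2)) @^-1`
     ((fun z : S1 * S2 => F (z.1, (i, z.2))) @^-1` B))).
  apply: bigcupT_measurable => i; apply: measurableI.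
    apply: (@measurable_preimageT _ _ _ nat (fun z : S1 * (nat * S2) => z.2.1) [set i]) => //.
    exact: measurableT_comp.
  apply: (@measurable_preimageT _ _ _ _ (fun z : S1 * (nat * S2) => (z.1, z.2.2))).
    by apply: measurable_fun_pair => //; exact: measurableT_comp.
  exact: measurable_preimageT.
apply/seteqP; split => [[s [i y]] FB|[s [i y]] [k _ [/= <-]]] //.
by exists i.
Qed.

Lemma ae_iff_measure (R : realType) d (S : measurableType d)
    (m : {measure set S -> \bar R}) (A B : set S) : measurable A -> measurable B ->
  {ae m, forall x, A x <-> B x} -> m A = m B.
Proof.
move=> mA mB AB; rewrite -[in LHS](setIT A) -[in RHS](setIT B) -!integral_indic//.
apply: ge0_ae_eq_integral => //.
- by apply/measurable_EFinP; exact: measurable_indic.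
- by apply/measurable_EFinP; exact: measurable_indic.
- apply: filterS AB => x ABx _; rewrite !indicE; congr ((nat_of_bool _)%:R%:E).
  by apply/idP/idP; rewrite !inE => /ABx.
Qed.

Lemma probability1_ae (R : realType) d (S : measurableType d) (P : probability S R)
    (A : set S) : measurable A -> P A = 1 -> {ae P, forall x, A x}.
Proof.
move=> mA PA; exists (~` A); split => //; first exact: measurableC.
by rewrite probability_setC// PA subee.
Qed.

(** * The normalised representation *)

Section NormalisedTilt.
Context {R : realType} {d} {T : measurableType d} (mu : {measure set T -> \bar R}).

Lemma max_excessB n (y x : 'I_n -> \bar R) (c : R) :
  max_excess (fun j => y j - c%:E) x = max_excess y x - c%:E.
Proof.
rewrite /max_excess; elim/big_rec2: _ => //= j a b _ ->.
rewrite (addeAC (y j)) /Order.max lteD2rE//.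
by case: ifPn.
Qed.

(** The subtracted z h appears once in z (t j) - z h and once in the logarithm of the
total mass, and cancels; the remaining factor e^(z h) / S integrates to 1. If z h
is -oo the weight e^(z h) makes the integrand vanish. *)
Lemma integral_normalised_tilt n (z : T -> \bar R) (t : 'I_n -> T) (x : 'I_n -> \bar R) :
  measurable_fun setT z -> (forall s, z s < +oo) ->
  0 < \int[mu]_s expeR (z s) < +oo ->
  \int[mu]_h (expeR (z h) * expeR (max_excess
    (fun j => (z (t j) - z h) - lne (\int[mu]_s expeR (z s - z h))) x)) =
  expeR (max_excess (fun j => z (t j)) x).
Proof.
move=> mz zy /andP[S0 Sy].
have mez : measurable_fun setT (fun s => expeR (z s)).
  exact: (measurableT_comp measurable_expeR).
have ez0 s : 0 <= expeR (z s) by exact: expeR_ge0.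
have [S SE] : exists S, \int[mu]_s expeR (z s) = S%:E.
  by exists (fine (\int[mu]_s expeR (z s))); rewrite fineK// ge0_fin_numE// ltW.
have Sgt0 : (0 < S)%R by rewrite -lte_fin -SE.
set M := max_excess _ x.
transitivity (\int[mu]_h (expeR (z h) * (expeR M * (S^-1)%:E))).
  apply: eq_integral => h _.
  have := zy h; case zhE : (z h) => [r||]// _; last by rewrite /= !mul0e.
  congr (_ * _).
  have -> : \int[mu]_s expeR (z s - r%:E) = (expR (- r) * S)%:E.
    under eq_integral do rewrite expeRB.
    by rewrite ge0_integralZl ?lee_fin ?expR_ge0// SE.
  rewrite lne_EFin ?mulr_gt0 ?expR_gt0// lnM ?posrE ?expR_gt0// expRK.
  have -> : (fun j => z (t j) - r%:E - (- r + ln S)%:E) = (fun j => z (t j) - (ln S)%:E).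
    apply/funext => j; rewrite -addeA; congr (_ + _).
    by rewrite -EFinN -EFinN -EFinD -EFinN; congr _%:E; ring.
  by rewrite max_excessB expeRB -lnV ?posrE// lnK ?posrE ?invr_gt0// muleC.
rewrite ge0_integralZr//; last by rewrite mule_ge0 ?expeR_ge0// lee_fin invr_ge0 ltW.
by rewrite SE muleCA -EFinM divff ?mule1// gt_eqF.
Qed.

End NormalisedTilt.

Section NormalisedRepresentation.
Context {R : realType} {dT} {T : measurableType dT}.
Context {d} {Omega : measurableType d} (P : probability Omega R) (Z : T -> Omega -> \bar R).
Hypothesis Zp : is_process Z.
Hypothesis Z1 : forall t, \int[P]_w expeR (Z t w) = 1.
Hypothesis Zfin : forall h, P [set w | -oo < Z h w] = 1.
Hypothesis Zjm : jointly_measurable Z.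
Context (mu : {sigma_finite_measure set T -> \bar R}).
Hypothesis mu0 : mu setT != 0.
Hypothesis Sfin : P [set w | \int[mu]_s expeR (Z s w) < +oo] = 1.

Local Notation nu := (@exp_intensity R).

Let mZ t : measurable_fun setT (Z t). Proof. by case: Zp. Qed.
Let Zy t w : Z t w < +oo. Proof. by case: Zp. Qed.

Let mZ' : measurable_fun setT (fun z : Omega * T => Z z.2 z.1).
Proof.
apply: (measurableT_comp Zjm (g := fun z : Omega * T => (z.2, z.1))).
exact: measurable_fun_pair.
Qed.

Let mtilt : measurable_fun setT (fun z : T * (Omega * T) => Z z.1 z.2.1 - Z z.2.2 z.2.1).
Proof.
apply: emeasurable_funB.
  apply: (measurableT_comp Zjm (g := fun z : T * (Omega * T) => (z.1, z.2.1))).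
  by apply: measurable_fun_pair => //; exact: measurableT_comp.
exact: (measurableT_comp mZ').
Qed.

Let mZpath w : measurable_fun setT (fun s => Z s w).
Proof. exact: (measurable_fun_pair1 (f := fun z : T * Omega => Z z.1 z.2)). Qed.

(** By Tonelli, almost every path is finite at mu-almost every point, and mu is not
zero. *)
Lemma ae_total_mass_gt0 : {ae P, forall w, 0 < \int[mu]_s expeR (Z s w)}.
Proof.
pose N : set (Omega * T) := [set z | Z z.2 z.1 = -oo].
have mN : measurable N.
  exact: (measurable_preimageT mZ' (emeasurable_set1 -oo)).
have N0 : (P \x mu) N = 0.
  rewrite product_ysection// integral0_eq// => h _.
  rewrite (_ : [set x | N (x, h)] = ~` [set w | -oo < Z h w]); last first.
    apply/seteqP; split => w /=; rewrite /N/=; first by move=> ->.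
    by move=> /negP; rewrite -leNgt leeNy_eq => /eqP.
  have mZh : measurable [set w | -oo < Z h w].
    by rewrite -[X in measurable X]setTI; apply: emeasurable_fun_o_infty => //; exact: mZ.
  by have := probability_setC P mZh; rewrite Zfin subee//; exact.
apply: filterS (ae_xsection_null mN N0) => w Nw.
have ez0 s : 0 <= expeR (Z s w) by exact: expeR_ge0.
have mez : measurable_fun setT (fun s => expeR (Z s w)).
  exact: (measurableT_comp measurable_expeR).
rewrite lt_neqAle integral_ge0 ?andbT//; apply/eqP => /esym S0.
have : \int[mu]_s `|expeR (Z s w)| = 0.
  by rewrite -[RHS]S0; apply: eq_integral => s _; exact: gee0_abs.
move=> /(ae_eq_integral_abs mu measurableT mez)[N' [mN' N'0 sN']].
move/eqP : mu0; apply; apply/eqP; rewrite -measure_le0.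
have mNw : measurable [set y | N (w, y)].
  rewrite (_ : [set y | _] = xsection N w); first exact: measurable_xsection.
  by apply/seteqP; split => y; rewrite /xsection/= inE.
apply: (@le_trans _ _ (mu (N' `|` [set y | N (w, y)]))).
  apply: le_measure; rewrite ?inE//; first exact: measurableU.
  move=> s _; have [Zs|Zs] := eqVneq (Z s w) -oo; [by right|left].
  apply: sN' => /= /(_ I) /eqP; rewrite expeR_eq0 => /eqP e.
  by move: Zs; rewrite e eqxx.
by rewrite measureU0// N'0.
Qed.

(** The mass that the points at location z.2 with mark Z - Z(z.2), normalised by the
constant c z, give to the exceedance of x: e^(Z(h)) comes from the tilt and the
exponential from nu. The total mass enters through an arbitrary c because it is
known almost everywhere only. *)
Definition tilted_excess n (t : 'I_n -> T) (x : 'I_n -> \bar R) (c : Omega * T -> \bar R)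
    (z : Omega * T) : \bar R :=
  expeR (Z z.2 z.1) *
  expeR (max_excess (fun j => (Z (t j) z.1 - Z z.2 z.1) - lne (c z)) x).

Lemma measurable_tilted_excess n (t : 'I_n -> T) x c :
  measurable_fun setT c -> measurable_fun setT (tilted_excess t x c).
Proof.
move=> mc; apply: emeasurable_funM; apply: (measurableT_comp measurable_expeR) => //.
apply: measurable_max_excess => j; apply: emeasurable_funB.
  by apply: emeasurable_funB => //; exact: (measurableT_comp (mZ (t j))).
exact: (measurableT_comp measurable_lne).
Qed.

Lemma tilted_excess_ge0 n (t : 'I_n -> T) x c z : 0 <= tilted_excess t x c z.
Proof. by rewrite mule_ge0// expeR_ge0. Qed.

Lemma integral_tilted_excess n (t : 'I_n -> T) (x : 'I_n -> \bar R) (c : Omega * T -> \bar R) :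
  measurable_fun setT c ->
  {ae P \x mu, forall z, c z = \int[mu]_s expeR (Z s z.1 - Z z.2 z.1)} ->
  \int[P \x mu]_z tilted_excess t x c z = exponent_measure_cdf P (fun j => Z (t j)) x.
Proof.
move=> mc cE.
pose I z := \int[mu]_s expeR (Z s z.1 - Z z.2 z.1).
have mI : measurable_fun setT I.
  apply: (@measurable_fun_fubini_tonelli_G _ _ _ _ _ mu
    (fun z : T * (Omega * T) => expeR (Z z.1 z.2.1 - Z z.2.2 z.2.1))).
    exact: (measurableT_comp measurable_expeR).
  by move=> z; exact: expeR_ge0.
have mS : measurable_fun setT (fun w => \int[mu]_s expeR (Z s w)).
  apply: (@measurable_fun_fubini_tonelli_G _ _ _ _ _ mu
    (fun z : T * Omega => expeR (Z z.1 z.2))).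
    exact: (measurableT_comp measurable_expeR).
  by move=> z; exact: expeR_ge0.
transitivity (\int[P \x mu]_z tilted_excess t x I z).
  apply: ge0_ae_eq_integral => //.
  - exact: measurable_tilted_excess.
  - exact: measurable_tilted_excess.
  - by move=> z _; exact: tilted_excess_ge0.
  - by move=> z _; exact: tilted_excess_ge0.
  - by apply: filterS cE => z cz _; rewrite /tilted_excess cz.
rewrite fubini_tonelli1; [|exact: measurable_tilted_excess|by move=> z; exact: tilted_excess_ge0].
apply: ge0_ae_eq_integral => //.
- apply: measurable_fun_fubini_tonelli_F; first exact: measurable_tilted_excess.
  by move=> z; exact: tilted_excess_ge0.
- apply: (measurableT_comp measurable_expeR); exact: measurable_max_excess.
- by move=> w _; apply: integral_ge0 => h _; exact: tilted_excess_ge0.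
- by move=> w _; exact: expeR_ge0.
have Sae : {ae P, forall w, \int[mu]_s expeR (Z s w) < +oo}.
  apply: probability1_ae => //; rewrite -[X in measurable X]setTI.
  exact: emeasurable_fun_infty_o.
apply: filterS2 ae_total_mass_gt0 Sae => w S0 Sy _.
rewrite /fubini_F /tilted_excess /I /=.
by apply: integral_normalised_tilt => //; rewrite S0.
Qed.

Context {d2} {Omega2 : measurableType d2} (P2 : probability Omega2 R).
Context (X : nat -> Omega2 -> R * T) (Xi : nat -> T -> Omega2 -> \bar R).
Hypothesis ppX : poisson_process P2 X (nu \x mu).
Hypothesis Xip : forall i, is_process (Xi i) /\ jointly_measurable (Xi i).
Hypothesis XiX : conditionally_independent P2 X Xi (fun x => spectral_law P Z x.2).

(** One functional has to serve for all the marks and for Z - Z(h) at all h. Both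
families are put in a single process over nat x Omega2 x Omega x T, the slice 0 of
the counting measure carrying the tilted paths and the slice i + 1 the i-th
mark. *)
Lemma path_total_mass : exists Phi : path_space R T -> \bar R,
  [/\ measurable_fun setT Phi,
      forall i, {ae P2, forall w, Phi (Xi i ^~ w) = \int[mu]_s expeR (Xi i s w)} &
      {ae P \x mu, forall z, Phi (fun s => Z s z.1 - Z z.2 z.1) =
        \int[mu]_s expeR (Z s z.1 - Z z.2 z.1)}].
Proof.
pose Y (z : T * (nat * (Omega2 * (Omega * T)))) : \bar R :=
  match z.2.1 with
  | 0%N => expeR (Z z.1 z.2.2.2.1 - Z z.2.2.2.2 z.2.2.2.1)
  | i.+1 => expeR (Xi i z.1 z.2.2.1)
  end.
have mY : measurable_fun setT Y.
  apply: measurable_nat_slices => -[|i] /=.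
    apply: (measurableT_comp measurable_expeR).
    apply: (measurableT_comp mtilt (g := fun z : T * (Omega2 * (Omega * T)) => (z.1, z.2.2))).
    by apply: measurable_fun_pair => //; exact: measurableT_comp.
  apply: (measurableT_comp measurable_expeR).
  apply: (measurableT_comp (Xip i).2 (g := fun z : T * (Omega2 * (Omega * T)) => (z.1, z.2.1))).
  by apply: measurable_fun_pair => //; exact: measurableT_comp.
have Y0 z : 0 <= Y z by rewrite /Y; case: (z.2.1) => [|i]; exact: expeR_ge0.
pose Q : {sigma_finite_measure set (nat * (Omega2 * (Omega * T)))%type -> \bar R} :=
  sigma_finite_product (@counting nat R)
    (sigma_finite_product P2 (sigma_finite_product P mu)).
have [Phi0 [mPhi0 Phi0E]] := path_integral_functional mY Y0 mu Q.
exists (fun f : path_space R T => Phi0 (fun s => expeR ((f : T -> \bar R) s))); split.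
- apply: (measurableT_comp mPhi0).
  apply: measurable_to_path => s; apply: (measurableT_comp measurable_expeR).
  exact: measurable_eval.
- move=> i; have H := @ae_counting_slices _ _ _ (sigma_finite_product P2 (sigma_finite_product P mu)) _ Phi0E i.+1.
  apply: (@ae_prod_fst _ _ _ _ _ P2 (sigma_finite_product P mu) (fun w =>
    Phi0 (fun s => expeR (Xi i s w)) = \int[mu]_s expeR (Xi i s w))); last exact: H.
  suff e : mu setT = (P \x mu) setT by move: mu0; rewrite e.
  rewrite -[LHS]mul1e -(probability_setT P) -[in RHS]setXTT.
  by rewrite product_measure1E.
- have H := @ae_counting_slices _ _ _ (sigma_finite_product P2 (sigma_finite_product P mu)) _ Phi0E 0%N.
  apply: (@ae_prod_snd _ _ _ _ _ P2 (sigma_finite_product P mu) (fun z =>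
    Phi0 (fun s => expeR (Z s z.1 - Z z.2 z.1)) =
    \int[mu]_s expeR (Z s z.1 - Z z.2 z.1))); last exact: H.
  have P2T : P2 setT != 0 by rewrite probability_setT onee_eq0.
  exact: P2T.
Qed.

Definition normalised_max (t : T) (w : Omega2) : \bar R :=
  ereal_sup (range (fun i : nat =>
    (X i w).1%:E + (Xi i t w - lne (\int[mu]_s expeR (Xi i s w))))).

Lemma measurable_normalised_max t : measurable_fun setT (normalised_max t).
Proof.
rewrite (_ : normalised_max t = fun w => esups (fun i =>
    (X i w).1%:E + (Xi i t w - lne (\int[mu]_s expeR (Xi i s w)))) 0%N).
  apply: measurable_fun_esups => i; have [[mXi _] jXi] := Xip i.
  apply: emeasurable_funD.
    by apply/measurable_EFinP; case: ppX => mX _ _; exact: measurableT_comp.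
  apply: emeasurable_funB => //; apply: (measurableT_comp measurable_lne).
  apply: (@measurable_fun_fubini_tonelli_G _ _ _ _ _ mu
    (fun z : T * Omega2 => expeR (Xi i z.1 z.2))).
    exact: (measurableT_comp measurable_expeR).
  by move=> z; exact: expeR_ge0.
apply/funext => w; rewrite /normalised_max /esups/=; congr ereal_sup.
by apply/seteqP; split => _ [i _ <-]; exists i.
Qed.

(** The maximum is below x when every point, shifted by its normalised mark, is. The
condition becomes measurable in the point and its mark once the total mass is
replaced by a measurable functional of the path; this changes nothing almost
surely. The intensity of the complement is evaluated by integrating first over p. *)
Theorem normalised_max_cdf n (t : 'I_n -> T) (x : 'I_n -> \bar R) :
  P2 [set w | forall j, normalised_max (t j) w <= x j] =
  expeR (- exponent_measure_cdf P (fun j => Z (t j)) x).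
Proof.
have [Phi [mPhi PhiXi PhiZ]] := path_total_mass.
pose M := path_space R T.
pose V i w : M := Xi i ^~ w.
pose u (z : (R * T) * Omega) := expeR (Z z.1.2 z.2).
pose v (z : (R * T) * Omega) : M := fun s => Z s z.2 - Z z.1.2 z.2.
pose G : set ((R * T) * M) := [set z |
  forall j, z.1.1%:E + ((z.2 : T -> \bar R) (t j) - lne (Phi z.2)) <= x j].
have mmax j : measurable_fun setT (normalised_max (t j)) by exact: measurable_normalised_max.
have mX i : measurable_fun setT (X i) by case: ppX.
have mV i : measurable_fun setT (V i) by apply: measurable_to_path; case: (Xip i) => -[].
have mu_ : measurable_fun setT u.
  apply: (measurableT_comp measurable_expeR).
  apply: (measurableT_comp mZ' (g := fun z : R * T * Omega => (z.2, z.1.2))).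
  by apply: measurable_fun_pair => //; exact: measurableT_comp.
have mv : measurable_fun setT v.
  apply: measurable_to_path => s; apply: emeasurable_funB; first exact: (measurableT_comp (mZ s)).
  apply: (measurableT_comp mZ' (g := fun z : R * T * Omega => (z.2, z.1.2))).
  by apply: measurable_fun_pair => //; exact: measurableT_comp.
have mG : measurable G.
  rewrite -[G]setCK; apply: measurableC.
  apply: (@measurable_preimageT _ _ _ _ (fun z : R * T * M => (z.1.1, z.2))
    [set z : R * M | ~ forall j, z.1%:E + ((z.2 : T -> \bar R) (t j) - lne (Phi z.2)) <= x j]).
    by apply: measurable_fun_pair => //; exact: measurableT_comp.
  apply: (@measurable_exceed _ _ M n
    (fun j (f : M) => (f : T -> \bar R) (t j) - lne (Phi f))) => j.
  apply: emeasurable_funB; first exact: measurable_eval.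
  exact: (measurableT_comp measurable_lne).
have u0 z : 0 <= u z by exact: expeR_ge0.
have ufin z : u z \is a fin_num.
  rewrite ge0_fin_numE// /u; have := Zy z.1.2 z.2.
  by case: (Z _ _) => //= r _; exact: ltry.
have u1 p : \int[P]_w u (p, w) = 1 by exact: Z1.
have marksX m (A : set Omega2) (C : nat -> set M) :
    sigma_gen setT X A -> (forall i, measurable (C i)) ->
    P2 (A `&` \bigcap_(i in `I_m) [set w | C i (V i w)]) =
    \int[P2]_(w in A) \prod_(i < m) mark_prob P u v (setT `*` C i) (X i w).
  move=> sA mC; rewrite (XiX m sA mC); apply: eq_integral => w _; apply: eq_bigr => i _.
  rewrite spectral_lawE//; apply: eq_integral => y _.
  congr (_ * (nat_of_bool _)%:R%:E); apply/idP/idP; rewrite !inE /v /=; first by split.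
  by case.
have := marked_poisson_void mX mV mu_ mv u0 ufin u1 marksX ppX mG.
have -> : P2 [set w | forall i, G (X i w, V i w)] =
    P2 [set w | forall j, normalised_max (t j) w <= x j].
  apply: ae_iff_measure.
  - rewrite (_ : [set w | _] = \bigcap_i ((fun w => (X i w, V i w)) @^-1` G)).
      apply: bigcapT_measurable => i; apply: measurable_preimageT => //.
      exact: measurable_fun_pair.
    by apply/seteqP; split => w H i; [move=> _; exact: H|exact: (H i I)].
  - rewrite (_ : [set w | _] = \bigcap_(j in [set: 'I_n]) [set w | normalised_max (t j) w <= x j]).
      apply: fin_bigcap_measurable => // j _; rewrite -[X in measurable X]setTI.
      apply: emeasurable_fun_infty_c => //; exact: mmax.
    by apply/seteqP; split => w H j; [move=> _; exact: H|exact: (H j I)].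
  - apply: filterS (ae_foralln PhiXi) => w Phiw; rewrite /G/=; split.
      move=> H j; apply: ge_ereal_sup => _ [i _ <-].
      by rewrite -Phiw; exact: H.
    move=> H i j; apply: le_trans (H j).
    by rewrite Phiw; apply: ereal_sup_ubound; exists i.
move=> ->; congr (expeR (- _)).
pose c (z : Omega * T) := Phi (fun s => Z s z.1 - Z z.2 z.1).
have mc : measurable_fun setT c.
  apply: (measurableT_comp mPhi); apply: measurable_to_path => s.
  by apply: emeasurable_funB => //; exact: (measurableT_comp (mZ s)).
rewrite -(integral_tilted_excess t x mc PhiZ).
have mGC : measurable (~` G) by exact: measurableC.
rewrite fubini_tonelli2; [|exact: measurable_mark_prob|by move=> z; exact: mark_prob_ge0].
rewrite [RHS]fubini_tonelli2; [|exact: measurable_tilted_excess|by move=> z; exact: tilted_excess_ge0].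
apply: eq_integral => h _; rewrite /fubini_G /mark_prob.
pose F (z : R * Omega) := u ((z.1, h), z.2) * (\1_(~` G) ((z.1, h), v ((z.1, h), z.2)))%:E.
have mF : measurable_fun setT F.
  have mk : measurable_fun setT (fun z : R * Omega => ((z.1, h), z.2)).
    by apply: measurable_fun_pair => //; apply: measurable_fun_pair.
  apply: emeasurable_funM; first exact: (measurableT_comp mu_).
  apply/measurable_EFinP.
  rewrite (_ : (fun z => _) =
      \1_((fun z : R * Omega => ((z.1, h), v ((z.1, h), z.2))) @^-1` (~` G))).
    apply: measurable_indic; apply: measurable_preimageT mGC.
    apply: measurable_fun_pair; first by apply: measurable_fun_pair.
    exact: (measurableT_comp mv).
  by apply/funext => z; rewrite !indicE; congr (_%:R); rewrite !inE.
have F0 z : 0 <= F z by rewrite mule_ge0// lee_fin indicE.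
rewrite (fubini_tonelli _ mF F0); apply: eq_integral => w _.
rewrite /F /tilted_excess /u /=.
pose y (j : 'I_n) := (Z (t j) w - Z h w) - lne (c (w, h)).
rewrite -[max_excess _ x]/(max_excess y x).
have -> : (fun p : R => expeR (Z h w) * (\1_(~` G) ((p, h), v ((p, h), w)))%:E) =
    fun p => expeR (Z h w) * (\1_[set p : R | (- max_excess y x < p%:E)%E] p)%:E.
  apply/funext => p; congr (_ * (nat_of_bool _)%:R%:E).
  by apply/idP/idP; rewrite !inE /G/= => /translated_le.
have my : measurable [set p : R | (- max_excess y x < p%:E)%E].
  by rewrite -[X in measurable X]setTI; apply: measurable_lte => //; apply/measurable_EFinP.
rewrite ge0_integralZl//; last 2 first.
  by apply/measurable_EFinP; exact: measurable_indic.
  exact: expeR_ge0.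
by rewrite integral_indic// setIT -[in RHS](oppeK (max_excess y x)) -exp_intensity_eray.
Qed.

End NormalisedRepresentation.

(** * Equality of finite dimensional distributions *)

Lemma eq_law_from_boxes (R : realType) n
    d (Omega : measurableType d) (P : probability Omega R) (X : 'I_n -> Omega -> \bar R)
    d' (Omega' : measurableType d') (P' : probability Omega' R)
    (X' : 'I_n -> Omega' -> \bar R) :
  (forall j, measurable_fun setT (X j)) -> (forall j, measurable_fun setT (X' j)) ->
  (forall x : 'I_n -> \bar R,
    P [set w | forall j, X j w <= x j] = P' [set w | forall j, X' j w <= x j]) ->
  eq_law P X P' X'.
Proof.
move=> mX mX' XX' B mB.
have boxE S (Y : 'I_n -> S -> \bar R) x :
    [set w | box x [tuple Y j w | j < n]] = [set w | forall j, Y j w <= x j].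
  by apply/seteqP; split => w H j; have := H j; rewrite tnth_mktuple.
pose m := image_measure P (measurable_mktuple mX).
pose m' := image_measure P' (measurable_mktuple mX').
have mE C : m C = P [set w | C [tuple X j w | j < n]] by [].
have m'E C : m' C = P' [set w | C [tuple X' j w | j < n]] by [].
rewrite -mE -m'E; apply: eq_measure_box => //.
  by rewrite mE probability_setT ltry.
by move=> x; rewrite mE m'E !boxE.
Qed.

Theorem theorem2p2 (R : realType) (k : coordinate_kind) (d : nat)
    (d_ge1 : (1 <= d)%N)
    (dO : measure_display) (Omega : measurableType dO) (P : probability Omega R)
    (Z : index_space R k d -> Omega -> \bar R)
    (Z_process : is_process Z)
    (Z_unit : forall t, \int[P]_w expeR (Z t w) = 1)
    (d1 : measure_display) (Omega1 : measurableType d1)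
    (P1 : probability Omega1 R)
    (zeta : index_space R k d -> Omega1 -> \bar R)
    (zeta_assoc : associated_max_stable P Z P1 zeta) :
  (forall (h : index_space R k d), P [set w | -oo < Z h w] = 1 ->
   forall (n : nat) (t : 'I_n.+1 -> index_space R k d),
     injective t -> t ord0 = h ->
   forall (d2 : measure_display) (Omega2 : measurableType d2)
     (P2 : probability Omega2 R) (Zh : index_space R k d -> Omega2 -> \bar R),
     is_tilt P Z h P2 Zh ->
   forall (d3 : measure_display) (Omega3 : measurableType d3)
     (P3 : probability Omega3 R) (W : 'I_n.+1 -> Omega3 -> \bar R),
     is_process W ->
     (forall x, joint_cdf P3 W x =
                gpd_cdf (joint_cdf P1 (fun j => zeta (t j))) x) ->
   forall (d4 : measure_display) (Omega4 : measurableType d4)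
     (P4 : probability Omega4 R) (Wh : 'I_n.+1 -> Omega4 -> \bar R),
     is_process Wh ->
     has_conditional_law P3 W [set w | 0 < W ord0 w] P4 Wh ->
   eq_law P2 (fun (j : 'I_n) w => Zh (t (lift ord0 j)) w - Zh h w)
          P4 (fun (j : 'I_n) w => Wh (lift ord0 j) w - Wh ord0 w))
  /\
  ((forall h, P [set w | -oo < Z h w] = 1) ->
   jointly_measurable Z ->
   forall mu : {sigma_finite_measure set (index_space R k d) -> \bar R},
     mu setT != 0 ->
     measurable_fun setT (fun w => \int[mu]_s expeR (Z s w)) ->
     P [set w | \int[mu]_s expeR (Z s w) < +oo] = 1 ->
   forall (d2 : measure_display) (Omega2 : measurableType d2)
     (P2 : probability Omega2 R)
     (X : nat -> Omega2 -> (R * index_space R k d)%type)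
     (Xi : nat -> index_space R k d -> Omega2 -> \bar R),
     poisson_process P2 X (@exp_intensity R \x mu) ->
     (forall i, is_process (Xi i) /\ jointly_measurable (Xi i)) ->
     conditionally_independent P2 X Xi (fun x => spectral_law P Z x.2) ->
   eq_fdd P1 zeta P2 (fun t w => ereal_sup (range (fun i : nat =>
     (X i w).1%:E + (Xi i t w - lne (\int[mu]_s expeR (Xi i s w))))))).
Proof.
have mZ t : measurable_fun setT (Z t) by case: Z_process.
split.
  move=> h _ n t _ <- d2 Omega2 P2 Zh tiltZh d3 Omega3 P3 W pW WG d4 Omega4 P4 Wh _ Whlaw.
  exact: (tilted_increments_law Z_process Z_unit zeta_assoc tiltZh pW WG Whlaw).
move=> Zfin Zjm mu mu0 _ Sfin d2 Omega2 P2 X Xi ppX Xip XiX n t.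
apply: eq_law_from_boxes => [j|j|x].
- exact: (measurable_max_stable zeta_assoc).
- exact: (measurable_normalised_max ppX Xip).
- rewrite (max_stable_cdf mZ zeta_assoc t x).
  by rewrite -(normalised_max_cdf Z_process Z_unit Zfin Zjm mu0 Sfin ppX Xip XiX t x).
Qed.
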